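(* Let $\sigma$ be the $\mathbb{F}_5$-algebra automorphism of $A=\mathbb{F}_5[S_3]$ that fixes $I,(1\,2\,3),(1\,3\,2)$ and sends each transposition $\tau$ to $4\tau=-\tau$. The minimal $(S_3,\sigma)$-convolutional codes $\mathcal{C}\subseteq\mathbb{F}_5[z]^6$ with $\rho_\sigma(\mathcal{C})\subseteq\mathcal{R}g_2$ are those having as $\mathbb{F}_5[z]$-basis the two vectors $$(3a_1+2a_2+c_2,\ 2a_1+2a_2+c_2,\ a_2+3c_1+2c_2,\ 3a_1+2a_2+2c_1+2c_2,\ 2a_1+2a_2+3c_1+2c_2,\ a_2+2c_1+2c_2),$$ $$(a_2+2c_1+2c_2,\ 3a_1+2a_2+2c_1+2c_2,\ 2a_1+2a_2+c_2,\ a_2+3c_1+2c_2,\ 3a_1+2a_2+c_2,\ 2a_1+2a_2+3c_1+2c_2),$$ where $$a_1=\sum_i 2^i\alpha_{2i}z^{2i},\quad a_2=\sum_i 2^i\alpha_{2i+1}z^{2i+1},\quad c_1=\sum_i 2^i\beta_{2i}z^{2i},\quad c_2=\sum_i 2^i\beta_{2i+1}z^{2i+1},$$ and $a=\sum_i\alpha_i z^i$, $c=\sum_i\beta_i z^i$ are any coprime polynomials in $\mathbb{F}_5[z]$, or $a=0,\ c=1$, or $a=1,\ c=0$. Every such code has rank $2$ and complexity $\max\{2\deg a,\,2\deg c\}$ (with $\deg 0=-\infty$).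
   Context: $\mathbb{F}_5$ is the field with 5 elements; the elements of the symmetric group $S_3$ are enumerated as $b_1=I$, $b_2=(1\,2)$, $b_3=(1\,3)$, $b_4=(2\,3)$, $b_5=(1\,2\,3)$, $b_6=(1\,3\,2)$, and products of permutations are composed from right to left, e.g. $(1\,2)(2\,3)=(1\,2\,3)$. $\mathcal{R}=A[z;\sigma]$ is the skew polynomial ring whose elements are written uniquely as $\sum_j z^j a_j$ ($a_j\in A$), with multiplication determined by $az=z\sigma(a)$ for $a\in A$; it is a left $\mathbb{F}_5[z]$-module by left multiplication. Put $g_1=2\bigl(I+(1\,2\,3)+(1\,3\,2)\bigr)$ and $g_2=I-g_1$; these are orthogonal central idempotents of $\mathcal{R}$ with $\mathcal{R}=\mathcal{R}g_1\oplus\mathcal{R}g_2$, and $Ag_2\cong M_2(\mathbb{F}_5)$. A convolutional code of length $6$ is a direct summand $\mathcal{C}$ of the $\mathbb{F}_5[z]$-module $\mathbb{F}_5[z]^6$; its dimension $k$ is its rank. An encoder is a matrix whose $k$ rows form an $\mathbb{F}_5[z]$-basis of $\mathcal{C}$, and the complexity of $\mathcal{C}$ is the maximal degree of the $k\times k$ minors of an encoder. The left $\mathbb{F}_5[z]$-module isomorphism $\rho_\sigma:\mathbb{F}_5[z]^6\to\mathcal{R}$ sends $\sum_j z^j(w_{j1},\dots,w_{j6})$ (with $w_{ji}\in\mathbb{F}_5$) to $\sum_j z^j\sum_{i=1}^6 w_{ji}b_i$. A convolutional code $\mathcal{C}$ is an $(S_3,\sigma)$-convolutional code if $\rho_\sigma(\mathcal{C})$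 is a left ideal of $\mathcal{R}$ that is a direct summand of $\mathcal{R}$ as a left $\mathcal{R}$-module; it is minimal if $\rho_\sigma(\mathcal{C})$ is indecomposable as a left $\mathcal{R}$-module. *)

(* Defs.v *)
From HB Require Import structures.
From mathcomp Require Import all_boot all_order all_algebra all_fingroup.
From mathcomp Require Import classical_sets.

Set Implicit Arguments.
Unset Strict Implicit.
Unset Printing Implicit Defensive.

Import GRing.Theory.
Local Open Scope ring_scope.
Local Open Scope classical_set_scope.

(* The group algebra F[S_T]; f : permalg F T stands for \sum_s (f s) s.
   Permutations are composed from right to left: the product of s and t is the
   function composite s \o t, which MathComp writes (t * s)%g. *)
Definition permalg (F : comNzRingType) (T : finType) :=
  {ffun {perm T} -> F^o}.

Section PermAlgebra.
Variables (F : comNzRingType) (T : finType).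
Implicit Types (f g h : permalg F T) (s t u w : {perm T}).

HB.instance Definition _ := GRing.Lmodule.copy (permalg F T)
  {ffun {perm T} -> F^o}.

Definition permalg_of s : permalg F T := [ffun t => (t == s)%:R].

(* The sum runs over the factorizations w = u \o (w * u^-1)%g. *)
Definition permalg_mul f g : permalg F T :=
  [ffun w => \sum_u (f u : F) * (g (w * u^-1)%g : F)].

Fact permalg_mulA : associative permalg_mul.
Proof.
move=> f g h; apply/ffunP=> w; rewrite !ffunE.
under eq_bigr => u _ do rewrite ffunE mulr_sumr.
under [RHS]eq_bigr => x _ do rewrite ffunE mulr_suml.
rewrite [RHS]exchange_big /=; apply: eq_bigr => u _.
rewrite [RHS](reindex_inj (mulIg u)) /=; apply: eq_bigr => v _.
by rewrite mulrA mulgK invMg mulgA.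
Qed.

Fact permalg_mul1 : left_id (permalg_of 1%g) permalg_mul.
Proof.
move=> f; apply/ffunP=> w; rewrite !ffunE (bigD1 1%g) //= ffunE eqxx mul1r.
rewrite invg1 mulg1 big1 ?addr0 // => u /negPf nu.
by rewrite ffunE nu mul0r.
Qed.

Fact permalg_mulr1 : right_id (permalg_of 1%g) permalg_mul.
Proof.
move=> f; apply/ffunP=> w; rewrite !ffunE (bigD1 w) //= ffunE mulgV eqxx.
rewrite mulr1 big1 ?addr0 // => u nu.
by rewrite ffunE -eq_mulgV1 eq_sym (negPf nu) mulr0.
Qed.

Fact permalg_mulDl : left_distributive permalg_mul +%R.
Proof.
move=> f g h; apply/ffunP=> w; rewrite !ffunE -big_split /=.
by apply: eq_bigr => u _; rewrite !ffunE mulrDl.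
Qed.

Fact permalg_mulDr : right_distributive permalg_mul +%R.
Proof.
move=> f g h; apply/ffunP=> w; rewrite !ffunE -big_split /=.
by apply: eq_bigr => u _; rewrite !ffunE mulrDr.
Qed.

Fact permalg_one_neq0 : permalg_of 1%g != 0.
Proof.
apply/eqP => /ffunP/(_ 1%g)/eqP.
by rewrite !ffunE eqxx oner_eq0.
Qed.

HB.instance Definition _ := GRing.Zmodule_isNzRing.Build (permalg F T)
  permalg_mulA permalg_mul1 permalg_mulr1 permalg_mulDl permalg_mulDr
  permalg_one_neq0.

Fact permalg_scaleAl (a : F) (f g : permalg F T) : a *: (f * g) = (a *: f) * g.
Proof.
apply/ffunP=> w; rewrite !ffunE scaler_sumr.
by apply: eq_bigr => u _; rewrite ffunE; exact: mulrA.
Qed.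

HB.instance Definition _ :=
  GRing.Lmodule_isLalgebra.Build F (permalg F T) permalg_scaleAl.

Fact permalg_scaleAr (a : F) (f g : permalg F T) : a *: (f * g) = f * (a *: g).
Proof.
apply/ffunP=> w; rewrite !ffunE scaler_sumr.
by apply: eq_bigr => u _; rewrite ffunE; exact: mulrCA.
Qed.

HB.instance Definition _ :=
  GRing.Lalgebra_isAlgebra.Build F (permalg F T) permalg_scaleAr.

Lemma permalg_ofM s t : permalg_of s * permalg_of t = permalg_of (t * s)%g.
Proof.
apply/ffunP=> w; rewrite !ffunE (bigD1 s) //= !ffunE eqxx mul1r big1 ?addr0.
  by rewrite (can2_eq (mulgKV s) (mulgK s)).
by move=> u /negPf nu; rewrite ffunE nu mul0r.
Qed.

(* Twisting by the sign character is an algebra automorphism. *)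
Definition sign_twist f : permalg F T := [ffun s : {perm T} => (-1) ^+ odd_perm s * f s].

Fact sign_twist_linear : linear sign_twist.
Proof.
by move=> a f g; apply/ffunP=> s; rewrite !ffunE mulrDr; congr (_ + _);
  exact: mulrCA.
Qed.

Fact sign_twist_monoid : monoid_morphism sign_twist.
Proof.
split=> [|f g]; apply/ffunP=> w; rewrite !ffunE.
  by case: eqP => [->|_]; rewrite ?odd_perm1 ?mul1r ?mulr0.
rewrite mulr_sumr; apply: eq_bigr => u _.
rewrite !ffunE mulrACA -signr_addb odd_permM odd_permV.
by case: (odd_perm u); case: (odd_perm w).
Qed.

HB.instance Definition _ :=
  GRing.isLinear.Build F (permalg F T) (permalg F T) *:%R sign_twist
    sign_twist_linear.
HB.instance Definition _ :=
  GRing.isMonoidMorphism.Build (permalg F T) (permalg F T) sign_twist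
    sign_twist_monoid.

Lemma sign_twistK : involutive sign_twist.
Proof. by move=> f; apply/ffunP=> s; rewrite !ffunE signrMK. Qed.

Lemma sign_twist_of s :
  sign_twist (permalg_of s) = (-1) ^+ odd_perm s *: permalg_of s.
Proof.
apply/ffunP=> t; rewrite !ffunE.
by case: (eqVneq t s) => [-> //|_]; rewrite mulr0 scaler0.
Qed.

End PermAlgebra.

(* The skew polynomial ring A[z; sigma]: the polynomial with coefficients a_j
   stands for \sum_j z^j a_j (coefficients on the right), and a z = z sigma(a),
   so that (z^i a) (z^j b) = z^(i + j) sigma^j(a) b. *)
Definition skewpoly (A : nzRingType) (sigma : {rmorphism A -> A}) := {poly A}.

Section SkewPoly.
Variables (A : nzRingType) (sigma : {rmorphism A -> A}).
Local Notation skew := (skewpoly sigma).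
Implicit Types p q r : skew.

HB.instance Definition _ := GRing.Zmodule.copy skew {poly A}.

Definition skew_mul p q : skew :=
  \poly_(k < (size p + size q).-1)
    \sum_(j < k.+1) iter (k - j) sigma p`_j * q`_(k - j).

Fact iter_skew0 n : iter n sigma 0 = 0.
Proof. by elim: n => //= n ->; rewrite rmorph0. Qed.

Fact iter_skew1 n : iter n sigma 1 = 1.
Proof. by elim: n => //= n ->; rewrite rmorph1. Qed.

Fact iter_skewD n : {morph iter n sigma : a b / a + b}.
Proof. by move=> a b; elim: n => //= n ->; rewrite rmorphD. Qed.

Fact iter_skewM n : {morph iter n sigma : a b / a * b}.
Proof. by move=> a b; elim: n => //= n ->; rewrite rmorphM. Qed.

Fact iter_skew_sum n I (s : seq I) (P : pred I) (E : I -> A) :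
  iter n sigma (\sum_(i <- s | P i) E i)
    = \sum_(i <- s | P i) iter n sigma (E i).
Proof. exact: (big_morph _ (iter_skewD n) (iter_skew0 n)). Qed.

Lemma coef_skew_mul p q k :
  (skew_mul p q)`_k = \sum_(j < k.+1) iter (k - j) sigma p`_j * q`_(k - j).
Proof.
rewrite coef_poly ltn_predRL; case: leqP => // le_pq_k1.
rewrite big1 // => j _; have [lq_p_j|lt_j_p] := leqP (size p) j.
  by rewrite nth_default // iter_skew0 mul0r.
rewrite [q`__]nth_default ?mulr0 // leq_subRL -ltnS //.
by rewrite (leq_trans _ le_pq_k1) // ltn_add2r.
Qed.

Lemma coef_skew_mul_rev p q k :
  (skew_mul p q)`_k = \sum_(j < k.+1) iter j sigma p`_(k - j) * q`_j.
Proof.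
rewrite coef_skew_mul (reindex_inj rev_ord_inj) /=.
by apply: eq_bigr => j _; rewrite (sub_ordK j).
Qed.

Fact skew_mulA : associative skew_mul.
Proof.
move=> p q r; apply/polyP=> i; rewrite coef_skew_mul coef_skew_mul_rev.
pose coef3 j k :=
  iter (i - j) sigma p`_j * (iter k sigma q`_(i - j - k) * r`_k).
transitivity (\sum_(j < i.+1) \sum_(k < i.+1 | (k <= i - j)%N) coef3 j k).
  apply: eq_bigr => /= j _; rewrite coef_skew_mul_rev big_distrr /=.
  by rewrite (big_ord_narrow_leq (leq_subr _ _)).
rewrite (exchange_big_dep predT) //=; apply: eq_bigr => k _.
transitivity (\sum_(j < i.+1 | (j <= i - k)%N) coef3 j k).
  apply: eq_bigl => j; rewrite -ltnS -(ltnS j) -!subSn ?leq_ord //.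
  by rewrite -subn_gt0 -(subn_gt0 j) -!subnDA addnC.
rewrite (big_ord_narrow_leq (leq_subr _ _)) coef_skew_mul iter_skew_sum.
rewrite big_distrl /=; apply: eq_bigr => j _.
have le_jk : (j + k <= i)%N.
  by have := leq_ord j; rewrite -(leq_add2r k) subnK ?leq_ord.
rewrite /coef3 iter_skewM -iterD -!mulrA -!subnDA (addnC k j) subnDA.
by rewrite addnC subnK // leq_subRL // (leq_trans (leq_addr k j)).
Qed.

Fact skew_mul1 : left_id (1%:P : skew) skew_mul.
Proof.
move=> p; apply/polyP=> i; rewrite coef_skew_mul big_ord_recl subn0.
rewrite coefC iter_skew1 mul1r big1 ?addr0 // => j _.
by rewrite coefC /= iter_skew0 mul0r.
Qed.

Fact skew_mulr1 : right_id (1%:P : skew) skew_mul.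
Proof.
move=> p; apply/polyP=> i; rewrite coef_skew_mul_rev big_ord_recl subn0.
rewrite coefC mulr1 big1 ?addr0 // => j _.
by rewrite coefC /= mulr0.
Qed.

Fact skew_mulDl : left_distributive skew_mul +%R.
Proof.
move=> p q r; apply/polyP=> i; rewrite coefD !coef_skew_mul -big_split /=.
by apply: eq_bigr => j _; rewrite coefD iter_skewD mulrDl.
Qed.

Fact skew_mulDr : right_distributive skew_mul +%R.
Proof.
move=> p q r; apply/polyP=> i; rewrite coefD !coef_skew_mul -big_split /=.
by apply: eq_bigr => j _; rewrite coefD mulrDr.
Qed.

Fact skew_one_neq0 : (1%:P : skew) != 0.
Proof. exact: (oner_neq0 {poly A}). Qed.

HB.instance Definition _ := GRing.Zmodule_isNzRing.Build skew
  skew_mulA skew_mul1 skew_mulr1 skew_mulDl skew_mulDr skew_one_neq0.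

Definition skewC (a : A) : skew := a%:P.
Definition skewX : skew := 'X.

Lemma skewC_commX a : skewC a * skewX = skewX * skewC (sigma a).
Proof.
apply/polyP=> i; rewrite !coef_skew_mul /skewC /skewX.
rewrite big_ord_recl big1 => [|j _]; last first.
  by rewrite coefC /= iter_skew0 mul0r.
rewrite addr0 subn0 coefC coefX; case: i => [|i].
  by rewrite mulr0 big_ord1 coefX mul0r.
rewrite 2!big_ord_recl big1 => [|j _]; last by rewrite coefX iter_skew0 mul0r.
rewrite !coefX iter_skew0 mul0r add0r addr0 iter_skew1 mul1r coefC.
by case: i => [|i]; rewrite ?mulr1 ?mulr0.
Qed.

End SkewPoly.

Section Submodules.
Variables (R : nzRingType) (V : lmodType R).
Implicit Types S T U : set V.

Definition is_submodule S :=
  S 0 /\ forall (a : R) (u v : V), S u -> S v -> S (a *: u + v).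

Definition is_direct_sum S T U :=
  S = [set t + u | t in T & u in U] /\ T `&` U = [set 0].

Definition is_direct_summand S :=
  is_submodule S /\ exists T, is_submodule T /\ is_direct_sum setT S T.

Definition is_indecomposable S :=
  [/\ is_submodule S, S <> [set 0] &
      forall T U, is_submodule T -> is_submodule U -> is_direct_sum S T U ->
        T = [set 0] \/ U = [set 0]].

End Submodules.

Section ConvolutionalCodes.
Variables (F : fieldType) (n : nat).
Implicit Type C : set 'rV[{poly F}]_n.

Definition is_conv_code C := is_direct_summand C.

Definition is_encoder k (G : 'M[{poly F}]_(k, n)) C :=
  C = range (fun x : 'rV_k => x *m G) /\
  forall x : 'rV_k, x *m G = 0 -> x = 0.

Definition has_rank C k := exists G : 'M_(k, n), is_encoder G C.

(* Increasing column selections f enumerate the k x k minors.  Counting the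
   zero polynomial as having degree 0 does not affect the maximum for an
   encoder, whose k x k minors do not all vanish. *)
Definition max_minor_deg k (G : 'M[{poly F}]_(k, n)) : nat :=
  \max_(f : {ffun 'I_k -> 'I_n} | 
      [forall i : 'I_k, forall j : 'I_k, (i < j)%N ==> (f i < f j)%N])
    (size (\det (colsub f G))).-1.

Definition has_complexity C (d : nat) :=
  (exists k (G : 'M_(k, n)), is_encoder G C) /\
  forall k (G : 'M_(k, n)), is_encoder G C -> max_minor_deg G = d.

End ConvolutionalCodes.

Notation F5S3 := (permalg 'F_5 'I_3).

(* The points 1, 2, 3 are the elements 0, 1, 2 of 'I_3. *)
Definition pt (k : nat) : 'I_3 := inord k.-1.

(* (1 2 3), sending 1 to 2, 2 to 3 and 3 to 1. *)
Definition rot3 : 'S_3 := perm (@ordS_inj 3).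

Definition S3_enum : seq 'S_3 :=
  [:: 1; tperm (pt 1) (pt 2); tperm (pt 1) (pt 3); tperm (pt 2) (pt 3);
      rot3; rot3^-1]%g.

Definition b (i : 'I_6) : F5S3 := permalg_of 'F_5 (nth 1%g S3_enum i).

Definition g1 : F5S3 :=
  2 * (1 + permalg_of 'F_5 rot3 + permalg_of 'F_5 rot3^-1%g).
Definition g2 : F5S3 := 1 - g1.

Section S3Codes.
Variable sigma : {rmorphism F5S3 -> F5S3}.
Local Notation R := (skewpoly sigma).
Implicit Type C : set 'rV[{poly 'F_5}]_6.

Definition rho (w : 'rV[{poly 'F_5}]_6) : R :=
  \sum_(i < 6) (map_poly (fun c : 'F_5 => c *: b i) (w 0 i) : R).

(* Left ideals of R are the submodules of the regular module R^o. *)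
Definition is_S3_code C :=
  is_conv_code C /\ is_direct_summand (rho @` C : set R^o).

Definition is_minimal_S3_code C :=
  is_S3_code C /\ is_indecomposable (rho @` C : set R^o).

Definition Rg2 : set R := range (fun r : R => r * skewC sigma g2).

End S3Codes.

Definition tw_even (p : {poly 'F_5}) : {poly 'F_5} :=
  \sum_(i < size p) (2 ^+ i * p`_(2 * i)%N) *: 'X^(2 * i)%N.
Definition tw_odd (p : {poly 'F_5}) : {poly 'F_5} :=
  \sum_(i < size p) (2 ^+ i * p`_(2 * i + 1)%N) *: 'X^(2 * i + 1)%N.

Definition code_rows (a c : {poly 'F_5}) : 'M[{poly 'F_5}]_(2, 6) :=
  let a1 := tw_even a in let a2 := tw_odd a in
  let c1 := tw_even c in let c2 := tw_odd c in
  \matrix_(i < 2, j < 6) nth 0 (nth [::] [::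
    [:: 3 * a1 + 2 * a2 + c2; 2 * a1 + 2 * a2 + c2; a2 + 3 * c1 + 2 * c2;
        3 * a1 + 2 * a2 + 2 * c1 + 2 * c2; 2 * a1 + 2 * a2 + 3 * c1 + 2 * c2;
        a2 + 2 * c1 + 2 * c2];
    [:: a2 + 2 * c1 + 2 * c2; 3 * a1 + 2 * a2 + 2 * c1 + 2 * c2;
        2 * a1 + 2 * a2 + c2; a2 + 3 * c1 + 2 * c2; 3 * a1 + 2 * a2 + c2;
        2 * a1 + 2 * a2 + 3 * c1 + 2 * c2]] i) j.

Definition admissible_pair (a c : {poly 'F_5}) :=
  coprimep a c \/ (a = 0 /\ c = 1) \/ (a = 1 /\ c = 0).

(* Main.v *)
Require Import Defs.
From HB Require Import structures.
From mathcomp Require Import all_boot all_order all_algebra all_fingroup.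
From mathcomp Require Import classical_sets.
From mathcomp Require Import boolp ring.
Set Implicit Arguments.
Unset Strict Implicit.
Unset Printing Implicit Defensive.
Import GRing.Theory.
Local Open Scope ring_scope.
Local Open Scope classical_set_scope.

(** On the factor A g2 of the group algebra, which is a matrix algebra M_2(F_5),
    the sign twist sigma is conjugation by a matrix S with S^2 = 2.  Hence
    t = z S commutes with A g2, and R g2 is not merely a skew polynomial ring but
    the ordinary matrix ring M_2(F_5[t]): the map [mxskew], which sends
    sum_k t^k M_k to sum_k z^k (S^k M_k), is an isomorphism onto it.  The relation
    t^2 = 2 z^2 is the origin of the powers 2^i in [tw_even] and [tw_odd].

    A left ideal of R that is a direct summand is generated by an idempotent E
    ([summand_idempotent]).  Inside M_2(F_5[t]) the idempotents 0 and 1 do not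
    give indecomposable ideals, and any other one has trace 1 and determinant 0,
    so it factors as a column u times a row w = (a, c) with w u = 1
    ([idempotent_mx2]); the last equation is a Bezout relation and says that a and
    c are coprime.  The ideal is then the set of all v w, v a column over F_5[t]
    ([row_idealE]).  Conversely every such ideal is a summand, and it is
    indecomposable because two nonzero multiples v w and v' w have a common
    nonzero left multiple ([row_ideal_indecomposable]).

    It remains to read the ideal as a module over F_5[z].  Since z = t S^-1 on
    R g2, every column over F_5[t] is, in a unique way, an F_5[z]-combination of
    the two unit columns, so the products of these columns with w form a basis.
    The two rows of [code_rows] are the coordinate vectors of these products, the
    first one up to sign ([rho_code_rows]).

    For the complexity put d = max (deg a, deg c).  The entries of the encoder have
    degree at most d, so its minors have degree at most 2 d.  The coefficient of
    z^(2 d) in the minor on the first and fifth columns is an anisotropic quadratic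
    form over F_5, up to a nonzero constant, evaluated at the coefficients of degree d
    of a and c, hence it does not vanish ([code_rows_max_minor]).  Two encoders of one
    code differ by an invertible matrix, so nothing depends on the encoder
    ([encoder_unimodular]). *)

(** * Matrices with polynomial entries *)

Section PolyMatrix.
Variable F : fieldType.

Definition coefmx m p k (X : 'M[{poly F}]_(m, p)) : 'M[F]_(m, p) :=
  \matrix_(i, j) (X i j)`_k.
Definition mxsize m p (X : 'M[{poly F}]_(m, p)) : nat :=
  \max_i \max_j size (X i j).
Definition mxpoly m p N (f : nat -> 'M[F]_(m, p)) : 'M[{poly F}]_(m, p) :=
  \matrix_(i, j) \poly_(k < N) f k i j.

Lemma coefmx_inj m p (X Y : 'M[{poly F}]_(m, p)) :
  (forall k, coefmx k X = coefmx k Y) -> X = Y.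
Proof.
move=> eXY; apply/matrixP => i j; apply/polyP => k.
by have /matrixP/(_ i j) := eXY k; rewrite !mxE.
Qed.

Lemma coefmx_ge_size m p (X : 'M[{poly F}]_(m, p)) k :
  (mxsize X <= k)%N -> coefmx k X = 0.
Proof.
move=> Xk; apply/matrixP => i j; rewrite !mxE nth_default //.
apply: leq_trans Xk; rewrite /mxsize (bigD1 i) //= (bigD1 j) //=.
by rewrite -maxnA leq_maxl.
Qed.

Lemma coefmx_mxpoly m p N (f : nat -> 'M[F]_(m, p)) k :
  coefmx k (mxpoly N f) = if (k < N)%N then f k else 0.
Proof.
by apply/matrixP => i j; rewrite !mxE coef_poly; case: ifP => _; rewrite ?mxE.
Qed.

Lemma coefmxD m p k (X Y : 'M[{poly F}]_(m, p)) :
  coefmx k (X + Y) = coefmx k X + coefmx k Y.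
Proof. by apply/matrixP => i j; rewrite !mxE coefD. Qed.

Lemma coefmxM m p q k (X : 'M[{poly F}]_(m, p)) (Y : 'M[{poly F}]_(p, q)) :
  coefmx k (X *m Y) = \sum_(j < k.+1) coefmx j X *m coefmx (k - j) Y.
Proof.
apply/matrixP => i l; rewrite !mxE coef_sum summxE.
under [RHS]eq_bigr => j _ do rewrite mxE.
rewrite exchange_big; apply: eq_bigr => r _; rewrite coefM.
by apply: eq_bigr => j _; rewrite !mxE.
Qed.

Lemma coefmx1 n k : coefmx k (1%:M : 'M[{poly F}]_n) = if k is 0%N then 1%:M else 0.
Proof.
apply/matrixP => i j; rewrite !mxE coefMn coef1.
by case: k => [|k]; rewrite !mxE ?mul0rn.
Qed.

(** The substitution sending sum_k t^k X_k to sum_k t^k (Q^k X_k). *)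
Definition mxtwist n p (Q : 'M[F]_n.+1) (X : 'M[{poly F}]_(n.+1, p)) :=
  mxpoly (mxsize X) (fun k => Q ^+ k *m coefmx k X).

Lemma coefmx_twist n p (Q : 'M[F]_n.+1) (X : 'M[{poly F}]_(n.+1, p)) k :
  coefmx k (mxtwist Q X) = Q ^+ k *m coefmx k X.
Proof.
rewrite coefmx_mxpoly; case: ltnP => // /coefmx_ge_size ->.
by rewrite mulmx0.
Qed.

Lemma mxtwistK n p (Q T : 'M[F]_n.+1) : Q *m T = 1%:M ->
  cancel (@mxtwist n p T) (mxtwist Q).
Proof.
move=> QT X; apply: coefmx_inj => k; rewrite !coefmx_twist mulmxA.
suff -> : Q ^+ k *m T ^+ k = 1%:M by rewrite mul1mx.
have cQT : GRing.comm Q T.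
  by rewrite /GRing.comm -!mulmxE (mulmx1C QT) QT.
by rewrite mulmxE -exprMn_comm // -mulmxE QT expr1n.
Qed.
End PolyMatrix.

Lemma delta_mx_sandwich (R : comNzRingType) n (M : 'M[R]_n) i j :
  delta_mx i i *m M *m delta_mx j j = M i j *: delta_mx i j.
Proof.
rewrite -[delta_mx i i](mul_delta_mx (0 : 'I_1)) -[delta_mx j j](mul_delta_mx (0 : 'I_1)).
rewrite -mulmxA [_ *m (delta_mx j 0 *m _)]mulmxA -colE.
rewrite -[_ *m delta_mx 0 i *m _]mulmxA [delta_mx 0 i *m (_ *m _)]mulmxA -rowE.
have -> : row i (col j M) = (M i j)%:M :> 'M_1.
  by apply/matrixP => k l; rewrite !mxE !ord1.
by rewrite mul_scalar_mx -scalemxAr mul_delta_mx.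
Qed.

(** * Left ideals generated by idempotents *)

Section IdempotentIdeals.
Variable R : nzRingType.
Implicit Types (L : set R^o) (u v x : R).

(** Writing 1 = u + v along the decomposition of the ring, right multiplication
    by u is the projection onto L. *)
Lemma summand_idempotent L :
  is_direct_summand L -> exists2 u : R, L u & forall x, L x <-> x * u = x.
Proof.
move=> [[L0 LD] [K [[K0 KD] [sumLK LK0]]]].
have LM a x : L x -> L (a * x) by move=> Lx; rewrite -[_ * _]addr0; apply: LD.
have KM a x : K x -> K (a * x) by move=> Kx; rewrite -[_ * _]addr0; apply: KD.
have : [set: R^o] 1 by [].
rewrite sumLK => -[u Lu [v Kv uv1]]; exists u => // x; split=> [Lx|<-]; last exact: LM.
suff xv0 : x * v = 0 by rewrite -[RHS]mulr1 -uv1 mulrDr xv0 addr0.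
have : (L `&` K) (x * v).
  split; last exact: KM.
  have -> : x * v = (-1 : R) * (x * u) + x.
    have ex : x = x * u + x * v by rewrite -mulrDr uv1 mulr1.
    by rewrite [X in _ + X]ex mulN1r addKr.
  by apply: LD => //; apply: LM.
by rewrite LK0.
Qed.

Lemma idempotent_summand u :
  u * u = u -> is_direct_summand ([set x | x * u = x] : set R^o).
Proof.
move=> uu; split; first split=> [|a x y /= xu yu]; rewrite /= ?mul0r //.
  by rewrite mulrDl yu -[a *: x]/(a * x) -mulrA xu.
exists [set x | x * u = 0]; split; first split=> [|a x y /= xu yu]; rewrite /= ?mul0r //.
  by rewrite mulrDl yu addr0 -[a *: x]/(a * x) -mulrA xu mulr0.
split; apply/seteqP; split=> x //=.
  move=> _; exists (x * u); first by rewrite /= -mulrA uu.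
  by exists (x - x * u); rewrite /= ?mulrBl -?mulrA ?uu ?subrr // addrC subrK.
  by move=> [->].
by move=> ->; rewrite /= mul0r.
Qed.
End IdempotentIdeals.

(** A splitting of an idempotent into orthogonal idempotents p and q splits the
    ideal it generates. *)
Lemma indecomposable_idempotents (R : nzRingType) (p q : R) :
  p * p = p -> q * q = q -> p * q = 0 -> q * p = 0 ->
  is_indecomposable ([set x | x * (p + q) = x] : set R^o) -> p = 0 \/ q = 0.
Proof.
move=> pp qq pq qp [_ _ indec].
have zero (u : R) : u * u = u -> [set x : R^o | x * u = x] = [set 0] -> u = 0.
  by move=> uu u0; have : [set x : R^o | x * u = x] u by []; rewrite u0.
have [subp _] := idempotent_summand pp; have [subq _] := idempotent_summand qq.
case: (indec _ _ subp subq) => [|/(zero _ pp)|/(zero _ qq)]; [|by left|by right].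
split; apply/seteqP; split=> x /=.
- move=> xpq; exists (x * p); first by rewrite /= -mulrA pp.
  by exists (x * q); rewrite /= -?mulrA ?qq // -mulrDr.
- move=> [y yp [z zq <-]]; have yq0 : y * q = 0 by rewrite -yp -mulrA pq mulr0.
  have zp0 : z * p = 0 by rewrite -zq -mulrA qp mulr0.
  by rewrite mulrDl !mulrDr yp zq yq0 zp0 addr0 add0r.
- by move=> [xp xq]; rewrite -[LHS]xp -xq -mulrA qp mulr0.
- by move=> ->; rewrite !mul0r.
Qed.

(** Complements pull back along a bijection, even when it is only semilinear: the
    scalars in P act on the ring R through g. *)
Lemma preimage_summand (P R : nzRingType) (V : lmodType P) (g : P -> R)
    (f : {additive V -> R}) (L : set R^o) :
  (forall p v, f (p *: v) = g p * f v) -> bijective f ->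
  is_direct_summand L -> is_direct_summand (f @^-1` L).
Proof.
move=> fZ [f' fK f'K].
have pre (K : set R^o) : is_submodule K -> is_submodule (f @^-1` K).
  move=> [K0 KD]; split=> [|p u w Ku Kw] /=; first by rewrite raddf0.
  by rewrite raddfD fZ; apply: KD.
move=> [subL [K [subK [LK LK0]]]]; split; first exact: pre.
exists (f @^-1` K); split; [exact: pre|split].
  apply/seteqP; split=> w //= _; have : [set: R^o] (f w) by [].
  rewrite LK => -[x Lx [y Ky xy]].
  exists (f' x); rewrite /= ?f'K //; exists (f' y); rewrite /= ?f'K //.
  by apply: (can_inj fK); rewrite raddfD !f'K.
apply/seteqP; split=> w /=.
  move=> [Lw Kw]; apply: (can_inj fK); rewrite raddf0.
  by have : (L `&` K) (f w) by []; rewrite LK0.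
by move=> ->; rewrite raddf0; split; [exact: subL.1|exact: subK.1].
Qed.

(** An idempotent E of trace different from 1 satisfies (tr E - 1) E_ij = 0 off the
    diagonal, so it is diagonal, hence 0 or 1.  If the trace is 1 then det E = 0, and
    dividing the first column by its greatest common divisor exhibits E as a
    product of a column by a row. *)
Lemma idempotent_mx2 (K : fieldType) (E : 'M[{poly K}]_2) :
  E *m E = E -> E != 0 -> E != 1%:M ->
  exists u : 'cV[{poly K}]_2, exists w : 'rV_2, E = u *m w /\ w *m u = 1%:M.
Proof.
move=> EE En0 En1.
pose i0 : 'I_2 := ord0; pose i1 : 'I_2 := lift ord0 ord0.
have ord2 (i : 'I_2) : i = if i == i0 then i0 else i1.
  by apply: val_inj; case: i => [[|[|]]].
have sum2 (f : 'I_2 -> {poly K}) : \sum_i f i = f i0 + f i1.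
  by rewrite !big_ord_recl big_ord0 addr0.
have outer (x y a c : {poly K}) : E i0 i0 = x * a -> E i0 i1 = x * c ->
    E i1 i0 = y * a -> E i1 i1 = y * c -> a * x + c * y = 1 ->
    exists u : 'cV[{poly K}]_2, exists w : 'rV_2, E = u *m w /\ w *m u = 1%:M.
  move=> e00 e01 e10 e11 axcy.
  exists (\col_i if i == i0 then x else y), (\row_j if j == i0 then a else c).
  split; apply/matrixP => i j.
    rewrite mxE big_ord1 !mxE (ord2 i) (ord2 j).
    by case: (i == i0); case: (j == i0).
  by rewrite !ord1 mxE sum2 !mxE.
have EEij i j : E i i0 * E i0 j + E i i1 * E i1 j = E i j.
  by have /matrixP/(_ i j) := EE; rewrite mxE sum2.
have [tr1|ntr1] := eqVneq (E i0 i0 + E i1 i1) 1; last first.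
  have tr_reg x : (E i0 i0 + E i1 i1) * x = x -> x = 0.
    move=> trx; apply/eqP; have : (E i0 i0 + E i1 i1 - 1) * x == 0.
      by rewrite mulrBl trx mul1r subrr.
    by rewrite mulf_eq0 subr_eq0 (negPf ntr1).
  have E01 : E i0 i1 = 0.
    by apply: tr_reg; rewrite mulrDl [E i1 i1 * _]mulrC EEij.
  have E10 : E i1 i0 = 0.
    by apply: tr_reg; rewrite mulrDl [E i0 i0 * _]mulrC EEij.
  have idem i : E i i = 0 \/ E i i = 1.
    have : E i i * (E i i - 1) == 0.
      rewrite mulrBr mulr1 subr_eq0; apply/eqP; have := EEij i i.
      rewrite (ord2 i); case: (i == i0);
        by rewrite E01 E10 mul0r ?addr0 ?add0r.
    by rewrite mulf_eq0 subr_eq0 => /orP[] /eqP; [left|right].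
  have eE x : E i0 i0 = x -> E i1 i1 = x -> E = x%:M.
    move=> e0 e1; apply/matrixP => i j; rewrite mxE (ord2 i) (ord2 j).
    by case: (i == i0); case: (j == i0); rewrite /= ?e0 ?e1 ?E01 ?E10 ?mulr0n.
  case: (idem i0) (idem i1) => e0 [] e1.
  - by rewrite (eE 0) ?scalemx0 ?raddf0 ?eqxx // in En0.
  - by rewrite e0 e1 add0r eqxx in ntr1.
  - by rewrite e0 e1 addr0 eqxx in ntr1.
  - by rewrite (eE 1) ?eqxx // in En1.
have s1 : E i1 i1 = 1 - E i0 i0 by rewrite -tr1 addrC addKr.
have det0 : E i0 i1 * E i1 i0 = E i0 i0 * E i1 i1.
  rewrite s1 mulrBr mulr1; apply: (addrI (E i0 i0 * E i0 i0)).
  by rewrite EEij addrC subrK.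
(* A zero corner is set apart: the division below needs a nonzero divisor. *)
have [p0|pn0] := eqVneq (E i0 i0) 0.
  move: s1 det0; rewrite p0 subr0 mul0r => s1 det0.
  apply: (outer (E i0 i1) 1 (E i1 i0) 1); rewrite ?mulr1 ?mul1r ?p0 ?det0 //.
  by rewrite mulrC det0 add0r.
pose a := gcdp (E i0 i0) (E i1 i0).
have an0 : a != 0 by rewrite gcdp_eq0 negb_and pn0.
have ep : E i0 i0 = E i0 i0 %/ a * a by rewrite divpK // dvdp_gcdl.
have er : E i1 i0 = E i1 i0 %/ a * a by rewrite divpK // dvdp_gcdr.
have : coprimep (E i0 i0 %/ a) (E i1 i0 %/ a) by rewrite coprimep_div_gcd ?pn0.
move: (E i0 i0 %/ a) (E i1 i0 %/ a) ep er => x y ep er cxy.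
have xn0 : x != 0 by apply: contraNneq pn0 => x0; rewrite ep x0 mul0r.
have e1 : E i0 i1 * y = x * E i1 i1.
  by apply: (mulIf an0); rewrite -mulrA -er det0 ep mulrAC.
have xq : x %| E i0 i1 by rewrite -(Gauss_dvdpl _ cxy) e1 dvdp_mulr.
have eq : E i0 i1 = x * (E i0 i1 %/ x) by rewrite mulrC divpK.
move: (E i0 i1 %/ x) eq => c eq.
have es : E i1 i1 = y * c.
  by apply: (mulfI xn0); rewrite -e1 eq mulrAC mulrA.
apply: (outer x y a c) => //.
by rewrite mulrC [c * y]mulrC -ep -es.
Qed.

(** * Skew polynomials over a matrix factor *)

Section MatrixUnits.
Variables (F : fieldType) (A : algType F) (n : nat).
Variable e : 'I_n.+1 -> 'I_n.+1 -> A.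
Hypothesis eM : forall i j k l, e i j * e k l = (j == k)%:R *: e i l.
Hypothesis e_neq0 : forall i j, e i j != 0.
Implicit Types M N : 'M[F]_n.+1.

(** The embedding of the matrix algebra given by the matrix units e; it need not
    send 1 to 1, and [mxu 1%:M] is the idempotent that cuts out the matrix factor. *)
Definition mxu N : A := \sum_i \sum_j N i j *: e i j.

Fact mxu_linear : linear mxu.
Proof.
move=> a M N; rewrite /mxu scaler_sumr -big_split; apply: eq_bigr => i _ /=.
rewrite scaler_sumr -big_split; apply: eq_bigr => j _ /=.
by rewrite !mxE scalerDl scalerA.
Qed.
HB.instance Definition _ := GRing.isLinear.Build _ _ _ _ mxu mxu_linear.

Lemma mxuM M N : mxu (M *m N) = mxu M * mxu N.
Proof.
rewrite /mxu mulr_suml; apply: eq_bigr => i _.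
transitivity (\sum_j \sum_k (M i k * N k j) *: e i j).
  by apply: eq_bigr => j _; rewrite mxE scaler_suml.
rewrite exchange_big mulr_suml; apply: eq_bigr => k _ /=.
rewrite [RHS]mulr_sumr [RHS](bigD1 k) //= [X in _ = _ + X]big1 ?addr0 => [|l nl].
  rewrite mulr_sumr; apply: eq_bigr => j _.
  by rewrite -scalerAl -scalerAr eM eqxx scale1r scalerA.
rewrite mulr_sumr big1 // => j _.
by rewrite -scalerAl -scalerAr eM eq_sym (negPf nl) scale0r !scaler0.
Qed.

Lemma mxu_delta i j : mxu (delta_mx i j) = e i j.
Proof.
rewrite /mxu (bigD1 i) //= (bigD1 j) //= mxE !eqxx scale1r.
rewrite !big1 ?addr0 // => [k nk|k nk].
  by rewrite big1 // => l _; rewrite mxE (negPf nk) scale0r.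
by rewrite mxE (negPf nk) andbF scale0r.
Qed.

Lemma mxu_row_delta (Q : 'M[F]_n.+1) l (w : 'rV[F]_n.+1) :
  mxu (Q *m (delta_mx l 0 *m w)) = \sum_j w 0 j *: (mxu Q * e l j).
Proof.
rewrite {1}(row_sum_delta w) mulmx_sumr mulmx_sumr linear_sum.
apply: eq_bigr => j _; rewrite -!scalemxAr linearZ /= mul_delta_mx.
by rewrite mxuM mxu_delta.
Qed.

(** Multiplying by e i i and e j j on the two sides isolates one coordinate. *)
Lemma mxu_inj : injective mxu.
Proof.
apply: raddf_inj => M M0; apply/matrixP => i j; rewrite [RHS]mxE.
have : mxu (delta_mx i i *m M *m delta_mx j j) = 0 by rewrite !mxuM M0 mulr0 mul0r.
rewrite delta_mx_sandwich linearZ /= mxu_delta => /eqP.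
by rewrite scaler_eq0 (negPf (e_neq0 i j)) orbF => /eqP.
Qed.

Section Skew.
Variable sigma : {rmorphism A -> A}.
Local Notation R := (skewpoly sigma).
Variables (S T : 'M[F]_n.+1) (pi : A -> 'M[F]_n.+1).
(* The automorphism sigma is inner on the matrix factor: conjugation by S, with
   inverse T.  The map pi is the projection of A onto that factor. *)
Hypothesis ST : S *m T = 1%:M.
Hypothesis sigma_mxu : forall N, sigma (mxu N) = mxu (S *m N *m T).
Hypothesis mxu_pi : forall a, mxu (pi a) = a * mxu 1%:M.
Hypothesis mxu1_central : forall a, mxu 1%:M * a = a * mxu 1%:M.
Implicit Types X Y : 'M[{poly F}]_n.+1.

(** Substitution of z S for the variable.  As x z S = z sigma(x) S = z S x for x in
    the matrix factor, z S is central there and the substitution is a ring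
    morphism from ordinary to skew polynomials. *)
Definition mxskew X : R := \poly_(k < mxsize X) mxu (S ^+ k *m coefmx k X).
Definition skewunit : R := skewC sigma (mxu 1%:M).

Lemma coef_mxskew X k : (mxskew X)`_k = mxu (S ^+ k *m coefmx k X).
Proof.
rewrite coef_poly; case: ltnP => // /coefmx_ge_size ->.
by rewrite mulmx0 linear0.
Qed.

Lemma mulTS : T *m S = 1%:M. Proof. exact: mulmx1C. Qed.
Lemma mulTSX k : T ^+ k *m S ^+ k = 1%:M.
Proof.
have cTS : GRing.comm T S by rewrite /GRing.comm -!mulmxE mulTS ST.
by rewrite mulmxE -exprMn_comm // -mulmxE mulTS expr1n.
Qed.
Lemma mulSTX k : S ^+ k *m T ^+ k = 1%:M.
Proof. exact: mulmx1C (mulTSX k). Qed.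

Lemma iter_sigma_mxu k N : iter k sigma (mxu N) = mxu (S ^+ k *m N *m T ^+ k).
Proof.
elim: k => [|k IH] /=; first by rewrite !expr0 mul1mx mulmx1.
by rewrite IH sigma_mxu [S ^+ _.+1]exprS [T ^+ _.+1]exprSr -!mulmxE !mulmxA.
Qed.

Fact mxskew_is_additive : additive mxskew.
Proof.
suff D : {morph mxskew : X Y / X + Y}.
  have mxskew0 : mxskew 0 = 0 by apply: (addrI (mxskew 0)); rewrite -D !addr0.
  move=> X Y; rewrite D; congr (_ + _); apply: (addrI (mxskew Y)).
  by rewrite -D !subrr mxskew0.
move=> X Y; apply/polyP => k.
by rewrite coefD !coef_mxskew coefmxD mulmxDr linearD.
Qed.
HB.instance Definition _ := GRing.isZmodMorphism.Build _ R mxskew mxskew_is_additive.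

Lemma mxskewM X Y : mxskew (X *m Y) = mxskew X * mxskew Y.
Proof.
apply/polyP => k; rewrite coef_mxskew coefmxM mulmx_sumr raddf_sum.
rewrite [RHS]coef_skew_mul; apply: eq_bigr => j _.
rewrite !coef_mxskew iter_sigma_mxu -mxuM; congr mxu.
rewrite !mulmxA -[_ *m T ^+ _ *m S ^+ _]mulmxA mulTSX mulmx1 mulmxE -exprD.
by rewrite subnK // -ltnS.
Qed.

Lemma mxskew1 : mxskew 1%:M = skewunit.
Proof.
apply/polyP => k; rewrite coef_mxskew coefmx1 [RHS]coefC.
by case: k => [|k]; rewrite ?expr0 ?mul1mx // mulmx0 linear0.
Qed.

Lemma mxskew_inj : injective mxskew.
Proof.
move=> X Y eXY; apply: coefmx_inj => k; have := congr1 (fun r : R => r`_k) eXY.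
rewrite /= !coef_mxskew => /mxu_inj e_k.
by rewrite -[LHS]mul1mx -[RHS]mul1mx -(mulTSX k) -!mulmxA e_k.
Qed.

Lemma coef_skewunitr (r : R) k : (r * skewunit)`_k = r`_k * mxu 1%:M.
Proof.
rewrite coef_skew_mul_rev big_ord_recl subn0 coefC eqxx big1 ?addr0 // => j _.
by rewrite coefC mulr0.
Qed.

Lemma skewunitC (r : R) : skewunit * r = r * skewunit.
Proof.
apply/polyP => k; rewrite coef_skewunitr coef_skew_mul big_ord_recl subn0.
rewrite coefC eqxx iter_sigma_mxu mulmx1 mulSTX mxu1_central big1 ?addr0 // => j _.
by rewrite coefC iter_skew0 mul0r.
Qed.

(** The component in the matrix factor of a skew polynomial, rewritten in powers of
    z S by means of z^k = (z S)^k S^-k. *)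
Definition skewpull (r : R) := mxpoly (size r) (fun k => T ^+ k *m pi r`_k).

Lemma skewpullK (r : R) : mxskew (skewpull r) = r * skewunit.
Proof.
apply/polyP => k; rewrite coef_mxskew coef_skewunitr coefmx_mxpoly.
case: ltnP => [_|rk]; first by rewrite mulmxA mulSTX mul1mx mxu_pi.
by rewrite nth_default // mul0r mulmx0 linear0.
Qed.

Lemma mul_skewunit X : mxskew X * skewunit = mxskew X.
Proof. by rewrite -mxskew1 -mxskewM mulmx1. Qed.

Lemma mul_mxskew (r : R) X : r * mxskew X = mxskew (skewpull r *m X).
Proof. by rewrite mxskewM skewpullK -mulrA skewunitC mul_skewunit. Qed.

(** The image of the matrices over F[t] all of whose rows are multiples of w. *)
Definition row_ideal (w : 'rV[{poly F}]_n.+1) : set R^o :=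
  range (fun v : 'cV_n.+1 => mxskew (v *m w)).

(** When w u = 1 the matrix u w is idempotent, and v w (u w) = v w. *)
Lemma row_idealE (u : 'cV[{poly F}]_n.+1) (w : 'rV_n.+1) : w *m u = 1%:M ->
  row_ideal w = [set x : R | x * mxskew (u *m w) = x].
Proof.
move=> wu; apply/seteqP; split=> x /=.
  by move=> [v _ <-]; rewrite -mxskewM mulmxA -[_ *m w *m u]mulmxA wu mulmx1.
by rewrite mul_mxskew => <-; exists (skewpull x *m u); rewrite ?mulmxA.
Qed.

Lemma row_ideal_summand (u : 'cV[{poly F}]_n.+1) (w : 'rV_n.+1) :
  w *m u = 1%:M -> is_direct_summand (row_ideal w).
Proof.
move=> wu; rewrite (row_idealE wu); apply: idempotent_summand.
by rewrite -mxskewM mulmxA -[_ *m w *m u]mulmxA wu mulmx1.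
Qed.

(** Every nonzero submodule contains all multiples of some q E w with q a nonzero
    polynomial and E the first unit column.  For two submodules with such polynomials
    p and q the element (p q) E w is a nonzero common member, so they do not form a
    direct sum. *)
Lemma row_ideal_indecomposable (u : 'cV[{poly F}]_n.+1) (w : 'rV_n.+1) :
  w *m u = 1%:M -> is_indecomposable (row_ideal w).
Proof.
move=> wu; have [subL _] := row_ideal_summand wu.
have wI p (v v' : 'M_(p, 1)) : v *m w = v' *m w -> v = v'.
  by move=> vv'; rewrite -[v]mulmx1 -[v']mulmx1 -wu !mulmxA vv'.
split=> // [L0|P Q subP subQ [PQ PQ0]].
  have : row_ideal w (mxskew (u *m w)) by exists u.
  rewrite L0 => /= uw0; have : u *m w = 0 *m w.
    by apply: mxskew_inj; rewrite uw0 mul0mx raddf0.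
  move/wI => u0; move: wu; rewrite u0 mulmx0 => /matrixP/(_ 0 0)/eqP.
  by rewrite !mxE eq_sym oner_eq0.
have nonzero (K : set R^o) : is_submodule K -> K `<=` row_ideal w -> K <> [set 0] ->
    exists2 q : {poly F}, q != 0 & forall p, K (mxskew ((p * q) *: delta_mx 0 0 *m w)).
  move=> [K0 KD] KL Kn0.
  have [x Kx xn0] : exists2 x, K x & x != 0.
    apply: contrapT => nex; apply: Kn0; apply/seteqP; split=> [x Kx|x ->] //=.
    by apply: contrapT => /eqP xn0; apply: nex; exists x.
  have [v _ vx] := KL x Kx.
  have [i vi] : exists i, v i 0 != 0.
    apply/existsP; apply: contraNT xn0; rewrite negb_exists => /forallP v0.
    rewrite -vx; have -> : v = 0.
      by apply/matrixP => i j; rewrite ord1 mxE; apply/eqP; rewrite -[_ == _]negbK v0.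
    by rewrite mul0mx raddf0.
  exists (v i 0) => // p.
  have -> : (p * v i 0) *: delta_mx 0 0 = (p *: delta_mx 0 i : 'M_n.+1) *m v.
    rewrite -scalemxAl -[delta_mx 0 i](mul_delta_mx (0 : 'I_1)) -mulmxA -rowE.
    have -> : row i v = (v i 0)%:M by apply/matrixP => k l; rewrite !mxE !ord1.
    by rewrite mul_mx_scalar scalerA.
  by rewrite -mulmxA mxskewM vx -[_ * _]addr0; apply: KD.
apply: contrapT => /not_orP[Pn0 Qn0].
have PL : P `<=` row_ideal w.
  rewrite PQ => x Px; exists x => //; exists 0; rewrite ?addr0 //; exact: subQ.1.
have QL : Q `<=` row_ideal w.
  rewrite PQ => x Qx; exists 0; first exact: subP.1.
  by exists x; rewrite ?add0r.
have [p pn0 Pp] := nonzero P subP PL Pn0; have [q qn0 Qq] := nonzero Q subQ QL Qn0.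
have : (P `&` Q) (mxskew ((q * p) *: delta_mx 0 0 *m w)).
  by split; [exact: Pp|rewrite mulrC; exact: Qq].
rewrite PQ0 /= => z0; have : (q * p) *: (delta_mx 0 0 : 'cV_n.+1) *m w = 0 *m w.
  by apply: mxskew_inj; rewrite z0 mul0mx raddf0.
move/wI/matrixP/(_ 0 0)/eqP; rewrite !mxE mulr1.
by rewrite mulf_eq0 (negPf pn0) (negPf qn0).
Qed.

(** The generating idempotent lies in the ideal, so it is the image of a matrix E.
    It is not 1 because the whole matrix ring of size at least 2 splits along the
    idempotents D and 1 - D, where D is the first diagonal matrix unit. *)
Lemma indecomposable_summand_idempotent (L : set R^o) : (0 < n)%N ->
  is_direct_summand L -> is_indecomposable L ->
  L `<=` range (fun r : R => r * skewunit) ->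
  exists E, [/\ E *m E = E, E != 0, E != 1%:M &
    L = [set x : R | x * mxskew E = x]].
Proof.
move=> n_gt0 /summand_idempotent[u Lu Lux] indL Lg.
have LE : L = [set x : R | x * u = x] by apply/seteqP; split=> x /Lux.
have [r _ ru] := Lg u Lu; rewrite -skewpullK in ru.
exists (skewpull r); rewrite ru; split=> //.
- by apply: mxskew_inj; rewrite mxskewM ru; apply/Lux.
- apply/eqP => r0; have [_ Ln0 _] := indL; apply: Ln0.
  rewrite LE -ru r0 raddf0; apply/seteqP; split=> x /=.
    by rewrite mulr0 => <-.
  by move=> ->; rewrite mul0r.
apply/eqP => r1; rewrite r1 in ru.
have i01 : (lift ord0 (Ordinal n_gt0) == ord0 :> 'I_n.+1) = false by [].
pose D : 'M[{poly F}]_n.+1 := delta_mx 0 0.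
have DD : D *m D = D by rewrite mul_delta_mx.
have D1 : D *m (1%:M - D) = 0 by rewrite mulmxBr mulmx1 DD subrr.
have D1' : (1%:M - D) *m D = 0 by rewrite mulmxBl mul1mx DD subrr.
have DD' : (1%:M - D) *m (1%:M - D) = 1%:M - D by rewrite {1}mulmxBl mul1mx D1 subr0.
have := @indecomposable_idempotents R (mxskew D) (mxskew (1%:M - D)).
rewrite -!mxskewM DD D1 D1' DD' raddf0 -raddfD /= [D + _]addrC subrK ru -LE.
move=> /(_ erefl erefl erefl erefl indL) [] D0.
  have : D = 0 by apply: mxskew_inj; rewrite D0 raddf0.
  by move/matrixP/(_ 0 0)/eqP; rewrite !mxE !eqxx oner_eq0.
have : 1%:M - D = 0 by apply: mxskew_inj; rewrite D0 raddf0.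
move/matrixP/(_ (lift ord0 (Ordinal n_gt0)) (lift ord0 (Ordinal n_gt0)))/eqP.
by rewrite !mxE !eqxx i01 subr0 oner_eq0.
Qed.

End Skew.
End MatrixUnits.

(** * Arithmetic in the group algebra of S_3 *)

(** Row i and column j hold the index of the product of the basis elements i and j
    in the enumeration [S3_enum]. *)
Definition S3_table : seq (seq nat) :=
  [:: [:: 0; 1; 2; 3; 4; 5]; [:: 1; 0; 5; 4; 3; 2]; [:: 2; 4; 0; 5; 1; 3];
      [:: 3; 5; 4; 0; 2; 1]; [:: 4; 2; 3; 1; 5; 0]; [:: 5; 3; 1; 2; 0; 4]]%N.
Definition S3_mul i j := nth 0 (nth [::] S3_table i) j.
(** The images of the points 0, 1, 2 under each element of [S3_enum]. *)
Definition S3_values : seq (seq nat) :=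
  [:: [:: 0; 1; 2]; [:: 1; 0; 2]; [:: 2; 1; 0]; [:: 0; 2; 1]; [:: 1; 2; 0]; [:: 2; 0; 1]]%N.
Definition S3_elt i : 'S_3 := nth 1%g S3_enum i.

Lemma val_pt k : (k < 3)%N -> val (pt k.+1) = k.
Proof. by move=> k3; rewrite /pt /= inordK. Qed.

Lemma S3_eltE i (x : 'I_3) : (i < 6)%N -> val (S3_elt i x) = nth 0 (nth [::] S3_values i) x.
Proof.
have tpE j k (y : 'I_3) : (j < 3)%N -> (k < 3)%N ->
   val (tperm (pt j.+1) (pt k.+1) y) = if val y == j then k else if val y == k then j else val y.
  move=> j3 k3; rewrite permE /= -!val_eqE !val_pt //.
  by case: ifP => _; [rewrite val_pt|case: ifP => _; rewrite ?val_pt].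
case: i => [|[|[|[|[|[|i]]]]]] // _; rewrite /S3_elt /=.
- by rewrite perm1; case: x => [[|[|[|]]]].
- by rewrite tpE //; case: x => [[|[|[|]]]].
- by rewrite tpE //; case: x => [[|[|[|]]]].
- by rewrite tpE //; case: x => [[|[|[|]]]].
- by rewrite permE; case: x => [[|[|[|]]]].
pose y : 'I_3 := inord ((x + 2) %% 3).
have -> : x = rot3 y.
  by apply: val_inj; rewrite permE /= inordK ?ltn_mod //; case: x {y} => [[|[|[|]]]].
rewrite permK permE /= inordK ?ltn_mod //.
by case: x {y} => [[|[|[|]]]].
Qed.
Lemma perm_val_inj (s t : 'S_3) : (forall x, val (s x) = val (t x)) -> s = t.
Proof. by move=> st; apply/permP => x; apply: val_inj. Qed.

Lemma S3_eltM i j : (i < 6)%N -> (j < 6)%N -> (S3_elt j * S3_elt i)%g = S3_elt (S3_mul i j).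
Proof.
move=> i6 j6.
have ij6 : (S3_mul i j < 6)%N.
  by move: i j i6 j6 => [|[|[|[|[|[|i]]]]]] // [|[|[|[|[|[|j]]]]]].
apply: perm_val_inj => x; rewrite permM !S3_eltE //.
by move: i j i6 j6 {ij6} x => [|[|[|[|[|[|i]]]]]] // [|[|[|[|[|[|j]]]]]] // _ _ [[|[|[|]]]].
Qed.
Lemma S3_elt_inj i j : (i < 6)%N -> (j < 6)%N -> S3_elt i = S3_elt j -> i = j.
Proof.
move=> i6 j6 /permP e.
have := congr1 val (e ord0); have := congr1 val (e (lift ord0 ord0)).
by rewrite !S3_eltE // {e}; move: i j i6 j6 => [|[|[|[|[|[|i]]]]]] // [|[|[|[|[|[|j]]]]]].
Qed.
Lemma S3_elt_bij : bijective (fun i : 'I_6 => S3_elt i).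
Proof.
apply: inj_card_bij => [i j /S3_elt_inj e|]; first by apply: val_inj; apply: e.
by rewrite card_ord card_Sn.
Qed.

(** Elements of the group algebra with coefficients given by natural numbers: their
    products are computed on lists, and identities in characteristic 5 between
    concrete elements become evaluations ([S3_combM], [S3_comb_mod]). *)
Definition S3_comb (v : seq nat) : F5S3 := \sum_(i < 6) (nth 0%N v i)%:R *: b i.

Lemma b_mulE (i j : 'I_6) : b i * b j = b (inord (S3_mul i j)).
Proof.
have ij6 : (S3_mul i j < 6)%N.
  by move: i j => [[|[|[|[|[|[|i]]]]]] // i6] [[|[|[|[|[|[|j]]]]]] // j6].
by rewrite /b permalg_ofM inordK //; congr permalg_of; apply: S3_eltM.
Qed.

Lemma nth_iota6 (f : nat -> nat) (i : 'I_6) :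
  nth 0%N [seq f k | k <- iota 0 6] i = f i.
Proof. by rewrite (nth_map 0%N) ?size_iota // nth_iota. Qed.

Definition S3_conv (v w : seq nat) : seq nat :=
  [seq sumn [seq sumn [seq if S3_mul i j == k then nth 0 v i * nth 0 w j else 0
                      | j <- iota 0 6] | i <- iota 0 6] | k <- iota 0 6]%N.

Lemma S3_combM v w : S3_comb v * S3_comb w = S3_comb (S3_conv v w).
Proof.
rewrite /S3_comb /S3_conv; under [RHS]eq_bigr => k _.
  rewrite nth_iota6 sumnE big_map natr_sum scaler_suml -[iota 0 6]/(index_iota 0 6) big_mkord.
  under eq_bigr => i _ do rewrite sumnE big_map natr_sum scaler_suml big_mkord.
  over.
rewrite exchange_big mulr_suml; apply: eq_bigr => i _ /=.
rewrite exchange_big mulr_sumr; apply: eq_bigr => j _ /=.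
have ij6 : (S3_mul i j < 6)%N.
  by move: i j => [[|[|[|[|[|[|i]]]]]] // i6] [[|[|[|[|[|[|j]]]]]] // j6].
rewrite (bigD1 (inord (S3_mul i j))) //= inordK // eqxx big1 ?addr0.
  by rewrite -scalerAl -scalerAr b_mulE natrM scalerA.
move=> k nk; case: eqP => [e|_]; last by rewrite scale0r.
by rewrite -val_eqE /= inordK // e eqxx in nk.
Qed.

Lemma S3_combD v w : S3_comb v + S3_comb w =
  S3_comb [seq nth 0 v i + nth 0 w i | i <- iota 0 6]%N.
Proof.
rewrite /S3_comb -big_split; apply: eq_bigr => i _.
by rewrite nth_iota6 natrD scalerDl.
Qed.

Lemma S3_combZ n v : n%:R *: S3_comb v = S3_comb [seq n * nth 0 v i | i <- iota 0 6]%N.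
Proof.
rewrite /S3_comb scaler_sumr; apply: eq_bigr => i _.
by rewrite nth_iota6 natrM scalerA.
Qed.

Lemma S3_comb_mod v w :
  all (fun i => nth 0 v i == nth 0 w i %[mod 5]) (iota 0 6) -> S3_comb v = S3_comb w.
Proof.
move=> /allP vw; apply: eq_bigr => i _; congr (_ *: _).
apply/eqP; move: (vw i); rewrite mem_iota /= ltn_ord => /(_ isT).
by rewrite -val_eqE /= !val_Fp_nat.
Qed.

Lemma permalg_scaleE (c : 'F_5) (f : F5S3) s : (c *: f) s = c * f s.
Proof. by rewrite ffunE. Qed.
Lemma permalg_of_coord (s t : 'S_3) : permalg_of 'F_5 s t = (t == s)%:R.
Proof. by rewrite ffunE. Qed.
Lemma permalg_combE I r (P : pred I) (c : I -> 'F_5) (p : I -> 'S_3) s :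
 (\sum_(i <- r | P i) c i *: permalg_of 'F_5 (p i)) s = \sum_(i <- r | P i) c i * (s == p i)%:R.
Proof.
apply: (big_rec2 (fun (x : F5S3) y => x s = y)) => [|i y f Pi IH]; first by rewrite ffunE.
by rewrite -IH -permalg_of_coord -permalg_scaleE ffunE.
Qed.
Lemma permalg_expand (f : F5S3) : f = \sum_s f s *: permalg_of 'F_5 s.
Proof.
apply/ffunP=> s; rewrite permalg_combE (bigD1 s) //= eqxx mulr1 big1 ?addr0 //.
by move=> t nt; rewrite eq_sym (negPf nt) mulr0.
Qed.

Lemma b_expand (f : F5S3) : f = \sum_(i < 6) f (S3_elt i) *: b i.
Proof.
rewrite {1}[f]permalg_expand (reindex (fun i : 'I_6 => S3_elt i)) //.
exact: onW_bij S3_elt_bij.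
Qed.

Lemma b_coord (x : 'I_6 -> 'F_5) (j : 'I_6) : (\sum_(i < 6) x i *: b i) (S3_elt j) = x j.
Proof.
rewrite /b permalg_combE (bigD1 j) //= eqxx mulr1 big1 ?addr0 // => i ni.
case: eqP => [/S3_elt_inj e|_]; last exact: mulr0.
by rewrite -val_eqE /= e ?eqxx in ni.
Qed.

(** * The matrix factor A g2 *)

(** Matrix units of A g2 adapted to the encoder: up to the signs [row_signs] they are
    the coefficients of a_1 and c_1 in its two rows. *)
Definition unit_coords : seq (seq nat) :=
  [:: [:: 2; 3; 0; 2; 3; 0]; [:: 0; 0; 2; 3; 2; 3];
      [:: 0; 3; 2; 0; 3; 2]; [:: 2; 2; 0; 3; 0; 3]]%N.
Definition munit (i j : 'I_2) : F5S3 := S3_comb (nth [::] unit_coords (2 * i + j)).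

Lemma munitM i j k l :
  munit i j * munit k l = (j == k)%:R *: munit i l.
Proof.
rewrite S3_combM S3_combZ; apply: S3_comb_mod.
by move: i j k l => [[|[|i]] // ?] [[|[|j]] // ?] [[|[|k]] // ?] [[|[|l]] // ?].
Qed.

Lemma S3_comb_coord v (j : 'I_6) : S3_comb v (S3_elt j) = (nth 0%N v j)%:R.
Proof. exact: b_coord. Qed.

Lemma munit_neq0 i j : munit i j != 0.
Proof.
apply/eqP => e0.
have coord0 (k : 'I_6) : (nth 0%N (nth [::] unit_coords (2 * i + j)) k)%:R = 0 :> 'F_5.
  by rewrite -S3_comb_coord -/(munit i j) e0 ffunE.
have /eqP := coord0 (@Ordinal 6 1 isT); have /eqP := coord0 (@Ordinal 6 2 isT).
by rewrite -!val_eqE /= {coord0 e0}; move: i j => [[|[|i]] // ?] [[|[|j]] // ?].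
Qed.

Definition mat2 (l : seq nat) : 'M['F_5]_2 := \matrix_(i, j) (nth 0%N l (2 * i + j))%:R.

Lemma mat2_eq l l' : all (fun i => nth 0 l i == nth 0 l' i %[mod 5]) (iota 0 4) -> mat2 l = mat2 l'.
Proof.
move=> /allP ll'; apply/matrixP => i j; rewrite !mxE; apply/eqP.
rewrite -val_eqE /= !val_Fp_nat //; apply: ll'.
by move: i j => [[|[|i]] // ?] [[|[|j]] // ?].
Qed.

Lemma mat2M l l' : mat2 l *m mat2 l' =
  mat2 [seq nth 0 l (2 * (k %/ 2)) * nth 0 l' (k %% 2) +
            nth 0 l (2 * (k %/ 2) + 1) * nth 0 l' (2 + k %% 2) | k <- iota 0 4]%N.
Proof.
apply/matrixP => i j; rewrite mxE !big_ord_recl big_ord0 !mxE addr0 -!natrM -natrD.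
by move: i j => [[|[|i]] // ?] [[|[|j]] // ?].
Qed.

Lemma mat2_1 : 1%:M = mat2 [:: 1; 0; 0; 1]%N.
Proof.
by apply/matrixP => i j; rewrite !mxE; move: i j => [[|[|i]] // ?] [[|[|j]] // ?].
Qed.

(** The coordinates of (1 3 2) - (1 2 3), which commutes with the rotations and
    anticommutes with the transpositions; conjugation by it is the sign twist. *)
Definition twist_mx := mat2 [:: 4; 3; 2; 1]%N.
Definition twist_inv := mat2 [:: 2; 4; 1; 3]%N.
Lemma twist_mxV : twist_mx *m twist_inv = 1%:M.
Proof. by rewrite mat2M mat2_1; apply: mat2_eq. Qed.

Local Notation phi := (mxu munit).

Definition mat2_comb (l : seq nat) : seq nat :=
  [seq sumn [seq nth 0 l m * nth 0 (nth [::] unit_coords m) k | m <- iota 0 4] | k <- iota 0 6]%N.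

Lemma sum22 (V : nmodType) (f : 'I_2 -> 'I_2 -> V) :
  \sum_i \sum_j f i j = f 0 0 + f 0 1 + (f 1 0 + f 1 1).
Proof.
rewrite !big_ord_recl !big_ord0 !addr0.
by have -> : lift ord0 ord0 = 1 :> 'I_2 by apply: val_inj.
Qed.

Lemma phi_mat2 l : phi (mat2 l) = S3_comb (mat2_comb l).
Proof.
rewrite /mxu.
transitivity (\sum_(i < 2) \sum_(j < 2) S3_comb
  [seq nth 0 l (2 * i + j) * nth 0 (nth [::] unit_coords (2 * i + j)) k | k <- iota 0 6]%N).
  by apply: eq_bigr => i _; apply: eq_bigr => j _; rewrite mxE /munit S3_combZ.
rewrite sum22 [in X in X + _]S3_combD [in X in _ + X]S3_combD [LHS]S3_combD.
apply: S3_comb_mod.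
by rewrite /mat2_comb /= !addn0 !addnA !eqxx.
Qed.

Lemma phi1 : phi 1%:M = S3_comb [:: 4; 0; 0; 0; 3; 3]%N.
Proof. by rewrite mat2_1 phi_mat2; apply: S3_comb_mod. Qed.

Lemma b_comb (i : 'I_6) : b i = S3_comb [seq (k == i :> nat) : nat | k <- iota 0 6]%N.
Proof.
rewrite [LHS]b_expand; apply: eq_bigr => j _; rewrite nth_iota6; congr (_ *: _).
rewrite permalg_of_coord; congr (nat_of_bool _)%:R.
by apply/eqP/eqP => [/S3_elt_inj|->] // ->.
Qed.

Lemma g2E : g2 = phi 1%:M.
Proof.
(* The factor 4 stands for -1 modulo 5. *)
have -> : g2 = b 0 + 4%:R *: (2%:R *: (b 0 + b (inord 4) + b (inord 5))).
  rewrite /g2 /g1 [2 * _]mulr_natl -[_ *+ 2]scaler_nat /b !inordK //=.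
  congr (_ + _); rewrite -scaleN1r; congr (_ *: _).
  exact: val_inj.
have -> : b 0 + b (inord 4) + b (inord 5) = S3_comb [:: 1; 0; 0; 0; 1; 1]%N.
  rewrite !b_comb [in X in X + _]S3_combD [LHS]S3_combD; apply: S3_comb_mod.
  by rewrite /= !inordK.
rewrite (S3_combZ 2) (S3_combZ 4) (b_comb 0) [LHS]S3_combD phi1.
exact: S3_comb_mod.
Qed.

(** The matrices of the two-dimensional irreducible representation. *)
Definition standard_rep : seq (seq nat) :=
  [:: [:: 1; 0; 0; 1]; [:: 4; 4; 0; 1]; [:: 0; 1; 1; 0];
      [:: 1; 0; 4; 4]; [:: 0; 1; 4; 4]; [:: 4; 4; 1; 0]]%N.
Definition rep_mx (a : F5S3) : 'M['F_5]_2 :=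
  \sum_(i < 6) a (S3_elt i) *: mat2 (nth [::] standard_rep i).

Lemma phi_rep_mx a : phi (rep_mx a) = a * phi 1%:M.
Proof.
rewrite [a in RHS]b_expand mulr_suml linear_sum; apply: eq_bigr => i _.
rewrite linearZ /= -scalerAl; congr (_ *: _).
rewrite phi_mat2 b_comb phi1 S3_combM; apply: S3_comb_mod.
by case: i => [[|[|[|[|[|[|i]]]]]] // ?].
Qed.

Lemma phi1_central a : phi 1%:M * a = a * phi 1%:M.
Proof.
rewrite [a]b_expand [RHS]mulr_suml [LHS]mulr_sumr; apply: eq_bigr => i _.
rewrite -scalerAl -scalerAr; congr (_ *: _).
rewrite b_comb phi1 [LHS]S3_combM [RHS]S3_combM; apply: S3_comb_mod.
by case: i => [[|[|[|[|[|[|i]]]]]] // ?].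
Qed.

Definition S3_signs : seq nat := [:: 1; 4; 4; 4; 1; 1]%N.
Section SignTwist.
Variable sigma : {lrmorphism F5S3 -> F5S3}.
Hypothesis sigma_b : forall i : 'I_6, sigma (b i) = (nth 0%N S3_signs i)%:R *: b i.

Lemma sigma_comb v :
  sigma (S3_comb v) = S3_comb [seq nth 0 S3_signs i * nth 0 v i | i <- iota 0 6]%N.
Proof.
rewrite linear_sum; apply: eq_bigr => i _; rewrite nth_iota6 linearZ /= sigma_b scalerA.
by rewrite mulrC natrM.
Qed.

Lemma sigma_phi N : sigma (phi N) = phi (twist_mx *m N *m twist_inv).
Proof.
rewrite {2}[N]matrix_sum_delta mulmx_sumr mulmx_suml !linear_sum.
apply: eq_bigr => i _; rewrite mulmx_sumr mulmx_suml !linear_sum.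
apply: eq_bigr => j _; rewrite -scalemxAr -scalemxAl !linearZ /=; congr (_ *: _).
rewrite !(mxuM munitM) !(mxu_delta munit) !phi_mat2 sigma_comb !S3_combM.
by apply: S3_comb_mod; move: i j => [[|[|i]] // ?] [[|[|j]] // ?].
Qed.

End SignTwist.

(** * The encoder as a polynomial in z S *)

(** The coefficients of the first row of the encoder give the negatives of the matrix
    units, and 4 = -1. *)
Definition row_signs : seq nat := [:: 4; 1]%N.
(** The coefficients of a_1, a_2, c_1 and c_2 in the two rows of the encoder. *)
Definition table_a1 : seq (seq nat) :=
  [:: [:: 3; 2; 0; 3; 2; 0]; [:: 0; 3; 2; 0; 3; 2]]%N.
Definition table_a2 : seq (seq nat) :=
  [:: [:: 2; 2; 1; 2; 2; 1]; [:: 1; 2; 2; 1; 2; 2]]%N.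
Definition table_c1 : seq (seq nat) :=
  [:: [:: 0; 0; 3; 2; 3; 2]; [:: 2; 2; 0; 3; 0; 3]]%N.
Definition table_c2 : seq (seq nat) :=
  [:: [:: 1; 1; 2; 2; 2; 2]; [:: 2; 2; 1; 2; 1; 2]]%N.

Lemma code_rowsE a c (l : 'I_2) (i : 'I_6) : code_rows a c l i =
  (nth 0 (nth [::] table_a1 l) i)%:R * tw_even a + (nth 0 (nth [::] table_a2 l) i)%:R * tw_odd a +
  ((nth 0 (nth [::] table_c1 l) i)%:R * tw_even c + (nth 0 (nth [::] table_c2 l) i)%:R * tw_odd c).
Proof.
rewrite mxE; move: (tw_even a) (tw_odd a) (tw_even c) (tw_odd c) => a1 a2 c1 c2.
move: l i => [[|[|l]] // ?] [[|[|[|[|[|[|i]]]]]] // ?] /=; ring.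
Qed.

Lemma coef_tw_even (p : {poly 'F_5}) k :
  (tw_even p)`_k = if odd k then 0 else 2 ^+ k./2 * p`_k.
Proof.
rewrite coef_sum; under eq_bigr => i _ do rewrite coefZ coefXn.
case: ifP => ok.
  rewrite big1 // => i _; case: eqP => [e|_]; last by rewrite mulr0.
  by rewrite e mul2n odd_double in ok.
have ek : (2 * k./2)%N = k by rewrite mul2n even_halfK ?ok.
have [kp|pk] := ltnP k./2 (size p).
  rewrite (bigD1 (Ordinal kp)) //= ek eqxx mulr1 big1 ?addr0 // => i ni.
  case: eqP => [e|_]; last by rewrite mulr0.
  by case/eqP: ni; apply: val_inj; rewrite /= e mul2n doubleK.
rewrite nth_default ?mulr0 ?big1 // => [i _|].
  case: eqP => [e|_]; last by rewrite mulr0.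
  by have := ltn_ord i; rewrite ltnNge -[nat_of_ord i]doubleK -mul2n -e pk.
by rewrite (leq_trans pk) // -{2}ek leq_pmull.
Qed.

Lemma coef_tw_odd (p : {poly 'F_5}) k :
  (tw_odd p)`_k = if odd k then 2 ^+ k./2 * p`_k else 0.
Proof.
rewrite coef_sum; under eq_bigr => i _ do rewrite coefZ coefXn.
case: ifP => ok; last first.
  rewrite big1 // => i _; case: eqP => [e|_]; last by rewrite mulr0.
  by rewrite e mul2n addn1 /= odd_double in ok.
have ek : (2 * k./2 + 1)%N = k by rewrite mul2n addn1 odd_halfK ?prednK // odd_gt0.
have [kp|pk] := ltnP k./2 (size p).
  rewrite (bigD1 (Ordinal kp)) //= ek eqxx mulr1 big1 ?addr0 // => i ni.
  case: eqP => [e|_]; last by rewrite mulr0.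
  by case/eqP: ni; apply: val_inj; rewrite /= e mul2n addnC (half_bit_double _ true).
rewrite nth_default ?mulr0 ?big1 // => [i _|].
  case: eqP => [e|_]; last by rewrite mulr0.
  by have := ltn_ord i; rewrite ltnNge -[nat_of_ord i](half_bit_double _ true) -mul2n addnC -e pk.
by rewrite (leq_trans pk) // -{2}ek addn1 ltnW // ltnS leq_pmull.
Qed.

Definition pair_row (K : nzRingType) (a c : K) : 'rV[K]_2 := \row_j if j == 0 then a else c.

Lemma coefmx_pair_row k (a c : {poly 'F_5}) :
  coefmx k (pair_row a c) = pair_row a`_k c`_k.
Proof. by apply/matrixP => i j; rewrite !mxE; case: ifP. Qed.

(** This is S^2 = 2, the source of the powers of 2 in the code. *)
Lemma twist_mxX k : twist_mx ^+ k = 2 ^+ k./2 *: (if odd k then twist_mx else 1%:M).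
Proof.
have sq : twist_mx * twist_mx = 2%:R%:M.
  rewrite -mulmxE mat2M; apply/matrixP => i j; rewrite !mxE; apply/eqP.
  by move: i j => [[|[|i]] // ?] [[|[|j]] // ?].
rewrite -{1}[k]odd_double_half addnC exprD -mul2n exprM expr2 sq.
rewrite -[_%:M]scalemx1 exprZn expr1n -scalerAl mul1r; congr (_ *: _).
by case: (odd k).
Qed.

Lemma coef_natrM (K : nzRingType) n (p : {poly K}) k : (n%:R * p)`_k = p`_k * n%:R.
Proof. by rewrite mulr_natl coefMn mulr_natr. Qed.

Lemma code_table (l : 'I_2) :
  let s : 'F_5 := (nth 0%N row_signs l)%:R in
  ((S3_comb (nth [::] table_a1 l) = s *: (phi 1%:M * munit l 0)) *
   (S3_comb (nth [::] table_a2 l) = s *: (phi twist_mx * munit l 0))) *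
  ((S3_comb (nth [::] table_c1 l) = s *: (phi 1%:M * munit l 1)) *
   (S3_comb (nth [::] table_c2 l) = s *: (phi twist_mx * munit l 1))).
Proof.
rewrite /= phi1 phi_mat2 /munit; do ! split.
all: rewrite S3_combM S3_combZ; apply: S3_comb_mod.
all: by case: l => [[|[|l]] // ?].
Qed.

(** The group algebra element formed by the coefficients of z^k in row l is, up to
    sign, S^k times the matrix with row l equal to the coefficients of degree k of a
    and c: even powers of S are scalar, odd ones are scalar multiples of S. *)
Lemma code_row_coef a c (l : 'I_2) k :
  \sum_(i < 6) (code_rows a c l i)`_k *: b i =
  phi (twist_mx ^+ k *m
    (delta_mx l 0 *m ((nth 0%N row_signs l)%:R *: coefmx k (pair_row a c)))).
Proof.
pose sgn : 'F_5 := (nth 0%N row_signs l)%:R.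
pose coord (t : seq (seq nat)) i : 'F_5 := (nth 0%N (nth [::] t l) i)%:R.
have colE (x y : 'F_5) : \sum_(i < 6)
     ((if odd k then 0 else x * coord table_a1 i + y * coord table_c1 i) +
      (if odd k then x * coord table_a2 i + y * coord table_c2 i else 0)) *: b i =
   phi ((if odd k then twist_mx else 1%:M) *m (delta_mx l 0 *m (sgn *: pair_row x y))).
  have lin (s t : seq (seq nat)) :
      \sum_(i < 6) (x * coord s i + y * coord t i) *: b i =
      x *: S3_comb (nth [::] s l) + y *: S3_comb (nth [::] t l).
    rewrite !scaler_sumr -big_split; apply: eq_bigr => i _.
    by rewrite scalerDl !scalerA.
  have phiE (Q : 'M['F_5]_2) : phi (Q *m (delta_mx l 0 *m (sgn *: pair_row x y))) =
      x *: (sgn *: (phi Q * munit l 0)) + y *: (sgn *: (phi Q * munit l 1)).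
    rewrite (mxu_row_delta munitM) big_ord_recl big_ord1 !mxE /= !scalerA.
    rewrite !(mulrC sgn).
    by have -> : lift ord0 ord0 = 1 :> 'I_2 by apply: val_inj.
  rewrite phiE; case: (odd k).
    under eq_bigr => i _ do rewrite add0r.
    by rewrite lin (code_table l).1.2 (code_table l).2.2.
  under eq_bigr => i _ do rewrite addr0.
  by rewrite lin (code_table l).1.1 (code_table l).2.1.
rewrite twist_mxX coefmx_pair_row -scalemxAl linearZ /= -colE scaler_sumr.
apply: eq_bigr => i _; rewrite scalerA; congr (_ *: _).
rewrite code_rowsE !coefD !coef_natrM !coef_tw_even !coef_tw_odd.
by rewrite /coord; case: (odd k); ring.
Qed.

(** * Codes as left ideals *)

Section S3SkewCodes.
Variable sigma : {lrmorphism F5S3 -> F5S3}.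
Hypothesis sigma_b : forall i : 'I_6, sigma (b i) = (nth 0%N S3_signs i)%:R *: b i.
Local Notation R := (skewpoly sigma).
Local Notation rho := (rho sigma).
Local Notation Phi := (mxskew munit sigma twist_mx).
Implicit Types (u w : 'rV[{poly 'F_5}]_6) (r : R).

Lemma coef_rho w k : (rho w)`_k = \sum_(i < 6) (w 0 i)`_k *: b i.
Proof.
rewrite /Defs.rho coef_sum; apply: eq_bigr => i _.
by rewrite coef_map_id0 // scale0r.
Qed.

Definition rho_inv r : 'rV[{poly 'F_5}]_6 :=
  \row_i \poly_(k < size r) ((r`_k : F5S3) (S3_elt i) : 'F_5).

Lemma rho_invK : cancel rho_inv rho.
Proof.
move=> r; apply/polyP => k; rewrite coef_rho.
under eq_bigr => i _ do rewrite mxE coef_poly.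
case: ltnP => [_|rk]; first exact/esym/b_expand.
by rewrite [RHS]nth_default // big1 // => i _; rewrite scale0r.
Qed.

Lemma rhoK : cancel rho rho_inv.
Proof.
move=> w; apply/matrixP => j i; rewrite ord1 mxE; apply/polyP => k.
have wk : (rho w)`_k (S3_elt i) = (w 0 i)`_k.
  by rewrite coef_rho (b_coord (fun i => (w 0 i)`_k)).
rewrite coef_poly; case: ltnP => // rk; rewrite -wk nth_default //.
by rewrite ffunE.
Qed.

Fact rho_additive : additive rho.
Proof.
move=> u w; apply/polyP => k; rewrite coefB [LHS]coef_rho [in X in _ = X - _]coef_rho.
rewrite [in X in _ = _ - X]coef_rho -sumrB.
by apply: eq_bigr => i _; rewrite !mxE coefB scalerBl.
Qed.
HB.instance Definition _ := GRing.isZmodMorphism.Build _ R rho rho_additive.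

Definition skew_scal (p : {poly 'F_5}) : R := map_poly (fun c : 'F_5 => c%:A : F5S3) p.

Lemma iter_sigma_scal k (c : 'F_5) : iter k sigma (c%:A : F5S3) = c%:A.
Proof. by elim: k => //= k ->; rewrite linearZ rmorph1. Qed.

Lemma rhoZ p w : rho (p *: w) = skew_scal p * rho w.
Proof.
apply/polyP => k; rewrite coef_rho [RHS](coef_skew_mul (skew_scal p) (rho w) k).
under eq_bigr => i _ do rewrite mxE coefM scaler_suml.
rewrite exchange_big; apply: eq_bigr => j _ /=.
rewrite coef_map_id0 ?scale0r // iter_sigma_scal coef_rho -scalerAl mul1r scaler_sumr.
by apply: eq_bigr => i _; rewrite scalerA.
Qed.

Lemma rho_preimage_summand (L : set R^o) :
  is_direct_summand L -> is_direct_summand (rho @^-1` L).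
Proof. by apply: preimage_summand rhoZ _; exists rho_inv; [exact: rhoK|exact: rho_invK]. Qed.

Definition sign_col (x : 'rV[{poly 'F_5}]_2) : 'cV[{poly 'F_5}]_2 :=
  \col_l ((nth 0%N row_signs l)%:R *: x 0 l).

Lemma sign_col_bij : bijective sign_col.
Proof.
have sq (l : 'I_2) (p : {poly 'F_5}) :
    (nth 0%N row_signs l)%:R *: ((nth 0%N row_signs l)%:R *: p) = p.
  rewrite scalerA -natrM -[RHS]scale1r; congr (_ *: _); apply/val_inj.
  by move: l => [[|[|l]] // ?].
exists (fun y : 'cV_2 => \row_l ((nth 0%N row_signs l)%:R *: y l 0)) => x;
  by apply/matrixP => i j; rewrite ord1 !mxE sq.
Qed.

(** The column is twisted by S^-1 because left multiplication by z is multiplication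
    by the matrix S^-1 followed by the central variable z S. *)
Lemma rho_code_rows a c (x : 'rV_2) :
  rho (x *m code_rows a c) = Phi (mxtwist twist_inv (sign_col x) *m pair_row a c).
Proof.
apply/polyP => k; rewrite coef_rho coef_mxskew coefmxM mulmx_sumr linear_sum.
under eq_bigr => i _ do rewrite mxE coef_sum scaler_suml.
rewrite exchange_big.
transitivity (\sum_l \sum_(j < k.+1) (x 0 l)`_j *:
   \sum_(i < 6) (code_rows a c l i)`_(k - j) *: b i).
  apply: eq_bigr => l _.
  transitivity (\sum_(i < 6) \sum_(j < k.+1)
      ((x 0 l)`_j * (code_rows a c l i)`_(k - j)) *: b i).
    by apply: eq_bigr => i _; rewrite coefM scaler_suml.
  rewrite exchange_big; apply: eq_bigr => j _ /=; rewrite scaler_sumr.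
  by apply: eq_bigr => i _; rewrite scalerA.
rewrite exchange_big; apply: eq_bigr => j _ /=.
rewrite coefmx_twist -mulmxA mulmxA.
have -> : twist_mx ^+ k *m twist_inv ^+ j = twist_mx ^+ (k - j).
  have jk : (j <= k)%N by rewrite -ltnS.
  by rewrite -{1}(subnK jk) exprD -mulmxE -mulmxA (mulSTX twist_mxV) mulmx1.
have -> : coefmx j (sign_col x) =
    \sum_l ((x 0 l)`_j * (nth 0%N row_signs l)%:R) *: delta_mx l 0.
  apply/matrixP => l o; rewrite ord1 summxE (bigD1 l) //= !mxE !eqxx mulr1.
  rewrite coefZ mulrC big1 ?addr0 // => m nm.
  by rewrite !mxE eq_sym (negPf nm) mulr0.
rewrite mulmx_suml mulmx_sumr linear_sum; apply: eq_bigr => l _.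
rewrite code_row_coef -[RHS]/(phi _) -!scalemxAl -!scalemxAr !linearZ /=.
rewrite [X in _ = X *: _]mulrC; exact: scalerA.
Qed.
End S3SkewCodes.

Lemma twist_invV : twist_inv *m twist_mx = 1%:M.
Proof. exact: mulmx1C twist_mxV. Qed.

(** This is Bezout's theorem for polynomials. *)
Lemma coprime_pair_row a c :
  coprimep a c <-> exists u : 'cV[{poly 'F_5}]_2, pair_row a c *m u = 1%:M.
Proof.
have sum2 (f : 'I_2 -> {poly 'F_5}) : \sum_i f i = f 0 + f 1.
  rewrite !big_ord_recl big_ord0 addr0.
  by have -> : lift ord0 ord0 = 1 :> 'I_2 by apply: val_inj.
split=> [/Bezout_eq1_coprimepP[[x y] /= xy1]|[u /matrixP/(_ 0 0)]].
  exists (\col_i if i == 0 then x else y); apply/matrixP => i j.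
  by rewrite !ord1 mxE sum2 !mxE /= mulrC [c * y]mulrC.
rewrite mxE sum2 !mxE /= => acu; apply/Bezout_eq1_coprimepP.
by exists (u 0 0, u 1 0); rewrite /= mulrC [u 1 0 * c]mulrC.
Qed.

Lemma pair_row_surj (w : 'rV[{poly 'F_5}]_2) : w = pair_row (w 0 0) (w 0 1).
Proof.
by apply/matrixP => i j; rewrite ord1 mxE; case: j => [[|[|j]] // ?]; congr (w _ _);
  apply: val_inj.
Qed.

Definition row_code a c := range (fun x : 'rV_2 => x *m code_rows a c).

Section S3Classification.
Variable sigma : {lrmorphism F5S3 -> F5S3}.
Hypothesis sigma_b : forall i : 'I_6, sigma (b i) = (nth 0%N S3_signs i)%:R *: b i.
Local Notation R := (skewpoly sigma).
Local Notation rho := (rho sigma).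
Local Notation Phi := (mxskew munit sigma twist_mx).
Local Notation ideal := (row_ideal munit (sigma := sigma) twist_mx).

Lemma rho_row_code a c : rho @` row_code a c = ideal (pair_row a c).
Proof.
apply/seteqP; split=> r /=.
  move=> [w [x _ <-] <-]; rewrite rho_code_rows.
  by exists (mxtwist twist_inv (sign_col x)).
move=> [v _ <-]; have [inv signK invK] := sign_col_bij.
exists (inv (mxtwist twist_mx v) *m code_rows a c); first by exists (inv (mxtwist twist_mx v)).
by rewrite rho_code_rows invK (mxtwistK twist_invV).
Qed.

Lemma row_code_encoder a c : coprimep a c -> is_encoder (code_rows a c) (row_code a c).
Proof.
move=> /coprime_pair_row[u wu]; split=> // x x0.
apply: (bij_inj sign_col_bij); apply: (can_inj (mxtwistK twist_mxV)).
suff D0 y : y *m code_rows a c = 0 -> mxtwist twist_inv (sign_col y) = 0.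
  by rewrite !D0 ?mul0mx.
move=> y0; have := rho_code_rows sigma a c y; rewrite y0 raddf0 => /esym Phi0.
have w0 : mxtwist twist_inv (sign_col y) *m pair_row a c = 0.
  by apply: (mxskew_inj munitM munit_neq0 twist_mxV (sigma := sigma)); rewrite Phi0 raddf0.
by rewrite -[LHS]mulmx1 -wu mulmxA w0 mul0mx.
Qed.

(** A factorization of the idempotent of the ideal provides the pair (a, c). *)
Lemma minimal_code_row_code (C : set 'rV[{poly 'F_5}]_6) :
  is_minimal_S3_code sigma C -> rho @` C `<=` @Rg2 sigma ->
  exists a c, coprimep a c /\ C = row_code a c.
Proof.
move=> [[_ sumL] indL] Lg2.
have [|E [EE En0 En1 LE]] := indecomposable_summand_idempotent munitM munit_neq0 twist_mxV
  (sigma_phi sigma_b) phi_rep_mx isT sumL indL.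
  move=> x /Lg2[r _ <-]; exists r; first by [].
  by rewrite [skewunit _ _]/skewunit -g2E.
have [u [w [Euw wu]]] := idempotent_mx2 EE En0 En1.
exists (w 0 0), (w 0 1); split; first by apply/coprime_pair_row; exists u; rewrite -pair_row_surj.
have : rho @` C = rho @` row_code (w 0 0) (w 0 1).
  rewrite rho_row_code -pair_row_surj LE Euw.
  exact: esym (row_idealE munitM twist_mxV (sigma_phi sigma_b) phi_rep_mx phi1_central wu).
have rho_inj := can_inj (@rhoK sigma).
move=> eC; apply/seteqP; split=> x Cx.
  have : (rho @` C) (rho x) by exists x.
  by rewrite eC => -[y Cy /rho_inj <-].
have : (rho @` row_code (w 0 0) (w 0 1)) (rho x) by exists x.
by rewrite -eC => -[y Cy /rho_inj <-].
Qed.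

Lemma row_code_minimal a c : coprimep a c ->
  is_minimal_S3_code sigma (row_code a c) /\ rho @` row_code a c `<=` @Rg2 sigma.
Proof.
move=> /coprime_pair_row[u wu].
have sumL := row_ideal_summand munitM twist_mxV (sigma_phi sigma_b) phi_rep_mx phi1_central wu.
have indL := row_ideal_indecomposable munitM munit_neq0 twist_mxV (sigma_phi sigma_b)
  phi_rep_mx phi1_central wu.
rewrite /is_minimal_S3_code /is_S3_code !rho_row_code; split; last first.
  move=> x [v _ <-]; exists (Phi (v *m pair_row a c)) => //.
  rewrite g2E; exact: (mul_skewunit munitM twist_mxV (sigma_phi sigma_b)).
split=> //; split=> //.
have -> : row_code a c = rho @^-1` ideal (pair_row a c).
  rewrite -rho_row_code; apply/seteqP; split=> x; first by exists x.
  by move=> [y Cy /(can_inj (@rhoK sigma)) <-].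
exact: rho_preimage_summand.
Qed.
End S3Classification.

(** * Degrees of minors and change of encoder *)

(** With formal degree d for each factor, leading coefficients multiply; the
    coefficient of degree d may vanish, which keeps the statement uniform. *)
Lemma prod_top_coef (K : idomainType) d (I : Type) (r : seq I) (f : I -> {poly K}) :
  (forall i, size (f i) <= d.+1)%N ->
  (size (\prod_(i <- r) f i)%R <= (size r * d).+1)%N /\
  (\prod_(i <- r) f i)`_(size r * d) = \prod_(i <- r) (f i)`_d.
Proof.
move=> fd; elim: r => [|i r [IHs IHc]].
  by rewrite !big_nil size_poly1 coef1.
rewrite !big_cons /= mulSn; split.
  apply: leq_trans (size_polyMleq _ _) _; move: (fd i) IHs.
  case: (size (f i)) => [|m] le_m le_prod.
    by rewrite /= (leq_trans (leq_pred _)) // (leq_trans le_prod) // ltnS leq_addl.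
  by rewrite addSn /= -addnS leq_add.
rewrite -IHc coefM.
have dlt : (d < (d + size r * d).+1)%N by rewrite ltnS leq_addr.
rewrite (bigD1 (Ordinal dlt)) //= addKn [X in _ + X]big1 ?addr0 // => j nj.
have [jd|dj|jd] := ltngtP j d.
- rewrite [X in _ * X]nth_default ?mulr0 // (leq_trans IHs) //.
  by rewrite ltn_subRL ltn_add2r.
- by rewrite [X in X * _]nth_default ?mul0r // (leq_trans (fd i)).
- by case/eqP: nj; apply: val_inj.
Qed.

Lemma det_top_coef (K : fieldType) d n (M : 'M[{poly K}]_n) :
  (forall i j, size (M i j) <= d.+1)%N ->
  (size (\det M)%R <= (n * d).+1)%N /\ (\det M)`_(n * d) = \det (coefmx d M).
Proof.
move=> Md; have top (s : 'S_n) := prod_top_coef (index_enum 'I_n) (fun i => Md i (s i)).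
have sn : size (index_enum 'I_n) = n by rewrite -[RHS]card_ord cardT enumT.
rewrite sn in top; split.
  apply: leq_trans (size_sum _ _ _) _; apply/bigmax_leqP => s _.
  by rewrite mulr_sign; case: (odd_perm s); rewrite ?size_polyN; apply: (top s).1.
rewrite coef_sum; apply: eq_bigr => s _.
rewrite !mulr_sign; case: (odd_perm s); rewrite ?coefN (top s).2.
  by congr (- _); apply: eq_bigr => i _; rewrite mxE.
by apply: eq_bigr => i _; rewrite mxE.
Qed.

Lemma det_mx2 (K : comNzRingType) (M : 'M[K]_2) :
  \det M = M 0 0 * M 1 1 - M 0 1 * M 1 0.
Proof.
have e1 : lift ord0 ord0 = 1 :> 'I_2 by apply: val_inj.
have e0 : lift 1 0 = 0 :> 'I_2 by apply: val_inj.
rewrite (expand_det_row _ 0) big_ord_recl big_ord1 /cofactor !det_mx11 !mxE /=.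
rewrite !e1 expr0 mul1r expr1 mulN1r mulrN.
by congr (_ * M _ _ - _ * M _ _); apply: val_inj.
Qed.

Lemma encoder_factor (K : fieldType) n (C : set 'rV[{poly K}]_n) k l
    (G : 'M_(k, n)) (H : 'M_(l, n)) :
  is_encoder G C -> is_encoder H C -> exists U, H = U *m G.
Proof.
move=> [CG _] [CH _].
have rowH i : exists x, row i H = x *m G.
  have : C (row i H) by rewrite CH; exists (delta_mx 0 i); rewrite // -rowE.
  by rewrite CG => -[x _ <-]; exists x.
have [x xG] := choice rowH; exists (\matrix_i x i).
by apply/row_matrixP => i; rewrite row_mul rowK.
Qed.

(** Each encoder has its rows in the row module of the other, and encoders cancel on
    the right. *)
Lemma encoder_unimodular (K : fieldType) n (C : set 'rV[{poly K}]_n) k l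
    (G : 'M_(k, n)) (H : 'M_(l, n)) :
  is_encoder G C -> is_encoder H C ->
  exists U V, [/\ H = U *m G, U *m V = 1%:M & V *m U = 1%:M].
Proof.
move=> CG CH; have [U HU] := encoder_factor CG CH.
have [V GV] := encoder_factor CH CG.
have inj p q (J : 'M[{poly K}]_(p, n)) (X Y : 'M_(q, p)) :
    is_encoder J C -> X *m J = Y *m J -> X = Y.
  move=> [_ Jinj] XY; apply/row_matrixP => i; apply/eqP; rewrite -subr_eq0; apply/eqP.
  by apply: Jinj; rewrite mulmxBl -!row_mul XY subrr.
exists U, V; split=> //.
  by apply: (inj _ _ H) => //; rewrite mul1mx -mulmxA -GV.
by apply: (inj _ _ G) => //; rewrite mul1mx -mulmxA -HU.
Qed.

Lemma encoder_rank_unique (K : fieldType) n (C : set 'rV[{poly K}]_n) k l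
    (G : 'M_(k, n)) (H : 'M_(l, n)) :
  is_encoder G C -> is_encoder H C -> k = l.
Proof.
move=> CG CH; have [U [V [_ UV VU]]] := encoder_unimodular CG CH.
by apply/eqP; rewrite eqn_leq (mulmx1_min UV) (mulmx1_min VU).
Qed.

(** By multiplicativity of determinants the minors change by det U, a unit of K[z] and
    hence a nonzero constant. *)
Lemma max_minor_deg_unique (K : fieldType) n (C : set 'rV[{poly K}]_n) k
    (G H : 'M_(k, n)) :
  is_encoder G C -> is_encoder H C -> max_minor_deg H = max_minor_deg G.
Proof.
move=> CG CH; have [U [V [-> UV _]]] := encoder_unimodular CG CH.
have [c cn0 detU] : exists2 c : K, c != 0 & \det U = c%:P.
  have : \det U \is a GRing.unit.
    by apply/unitrPr; exists (\det V); rewrite -det_mulmx UV det1.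
  rewrite poly_unitE => /andP[/size_poly1P[c cn0 ->] _].
  by exists c.
apply: eq_bigr => f _.
have -> : colsub f (U *m G) = U *m colsub f G.
  by apply/matrixP => i j; rewrite !mxE; apply: eq_bigr => m _; rewrite !mxE.
by rewrite det_mulmx detU size_Cmul.
Qed.

(** The upper bound counts degrees; the lower bound comes from one minor whose
    coefficient of degree 2 d is nonzero as soon as a or c has degree d. *)
Lemma code_rows_max_minor a c : coprimep a c ->
  max_minor_deg (code_rows a c) = maxn (2 * (size a).-1) (2 * (size c).-1).
Proof.
move=> cac; rewrite -maxnMr; set d := maxn _ _.
have entry_coef k l i : (code_rows a c l i)`_k =
  2 ^+ k./2 * (a`_k * (nth 0%N (nth [::] (if odd k then table_a2 else table_a1) l) i)%:R
             + c`_k * (nth 0%N (nth [::] (if odd k then table_c2 else table_c1) l) i)%:R).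
  rewrite code_rowsE !coefD !coef_natrM !coef_tw_even !coef_tw_odd.
  by case: (odd k); ring.
have ad : (size a <= d.+1)%N by rewrite (leq_trans (leqSpred _)) // ltnS leq_maxl.
have cd : (size c <= d.+1)%N by rewrite (leq_trans (leqSpred _)) // ltnS leq_maxr.
have Gd l i : (size (code_rows a c l i) <= d.+1)%N.
  apply/leq_sizeP => k dk; rewrite entry_coef.
  rewrite [a`_k]nth_default ?(leq_trans ad) // [c`_k]nth_default ?(leq_trans cd) //.
  by rewrite !mul0r addr0 mulr0.
(* If c = 0 then a is a nonzero constant and d = 0, so a still has degree d. *)
have ac0 : (a`_d != 0) || (c`_d != 0).
  have lead (p : {poly 'F_5}) : p != 0 -> (size p).-1 = d -> p`_d != 0.
    by move=> pn0 <-; rewrite -[_`__]/(lead_coef p) lead_coef_eq0.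
  have [le_ac|lt_ca] := leqP (size a).-1 (size c).-1.
    have dc : d = (size c).-1 by apply/maxn_idPr.
    have [c0|cn0] := eqVneq c 0; last by rewrite (lead c) ?orbT.
    rewrite (lead a) //; last first.
      by apply/eqP; move: le_ac; rewrite dc c0 size_poly0 leqn0.
    by apply: contraTneq cac => ->; rewrite c0 coprimep0 eqp01.
  rewrite (lead a) //; last by apply/esym/maxn_idPl/ltnW.
  by apply: contraTneq lt_ca => ->; rewrite size_poly0.
have minors f : (size (\det (colsub f (code_rows a c)))%R <= (2 * d).+1)%N /\
   (\det (colsub f (code_rows a c)))`_(2 * d) = \det (coefmx d (colsub f (code_rows a c))).
  by apply: det_top_coef => i j; rewrite mxE.
apply/eqP; rewrite eqn_leq; apply/andP; split.
  by apply/bigmax_leqP => f _; rewrite -subn1 leq_subLR add1n (minors f).1.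
(* On these two columns the form is anisotropic for both parities of d. *)
pose f : {ffun 'I_2 -> 'I_6} := [ffun j : 'I_2 => if j == 0 then inord 0 else inord 4].
have fE j : f j = (if j == 0 then 0%N else 4%N) :> nat.
  by rewrite ffunE; case: ifP => _; rewrite inordK.
have f_inc : [forall i : 'I_2, forall j : 'I_2, (i < j)%N ==> (f i < f j)%N].
  apply/forallP => i; apply/forallP => j; rewrite !fE.
  by move: i j => [[|[|i]] // ?] [[|[|j]] // ?].
suff det0 : \det (coefmx d (colsub f (code_rows a c))) != 0.
  apply: leq_trans (leq_bigmax_cond _ f_inc).
  rewrite -ltnS (leq_trans _ (leqSpred _)) // ltnNge; apply: contra det0 => le_size.
  by rewrite -(minors f).2 nth_default.
have two_h : (2 ^+ d./2 : 'F_5) != 0 by rewrite expf_neq0.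
have entry i j : coefmx d (colsub f (code_rows a c)) i j = (code_rows a c i (f j))`_d.
  by rewrite mxE [colsub _ _ _ _]mxE.
rewrite det_mx2 !entry !entry_coef !fE /=.
move: (a`_d) (c`_d) (2 ^+ d./2 : 'F_5) ac0 two_h (odd d) => x y h xy hn0 o.
rewrite mulrACA [X in _ - X]mulrACA -mulrBr !mulf_neq0 // -val_eqE.
(* The 24 nonzero pairs (x, y), for each parity. *)
by move: x y o xy => [[|[|[|[|[|x]]]]] // ?] [[|[|[|[|[|y]]]]] // ?] [] xy.
Qed.

Lemma admissible_coprime a c : admissible_pair a c -> coprimep a c.
Proof. by case=> [|[[-> ->]|[-> ->]]] //; rewrite ?coprimep1 ?coprime1p. Qed.

Theorem mainTheorem4
    (sigma : {lrmorphism F5S3 -> F5S3})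
    (sigma_bij : bijective sigma)
    (sigma_fix : forall s : 'S_3, s \in [:: 1; rot3; rot3^-1]%g ->
      sigma (permalg_of 'F_5 s) = permalg_of 'F_5 s)
    (sigma_transp : forall i j : 'I_3, i != j ->
      sigma (permalg_of 'F_5 (tperm i j)) = 4 *: permalg_of 'F_5 (tperm i j)) :
  (forall C : set 'rV[{poly 'F_5}]_6,
     (is_minimal_S3_code sigma C /\ rho sigma @` C `<=` @Rg2 sigma) <->
     exists a c : {poly 'F_5},
       admissible_pair a c /\ is_encoder (code_rows a c) C) /\
  (forall a c : {poly 'F_5}, admissible_pair a c ->
     exists C : set 'rV[{poly 'F_5}]_6, is_encoder (code_rows a c) C) /\
  (forall (a c : {poly 'F_5}) (C : set 'rV[{poly 'F_5}]_6),
     admissible_pair a c -> is_encoder (code_rows a c) C ->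
     has_rank C 2 /\
     has_complexity C (maxn (2 * (size a).-1) (2 * (size c).-1))).
Proof.
have sigma_b (i : 'I_6) : sigma (b i) = (nth 0%N S3_signs i)%:R *: b i.
  rewrite /b; case: i => [[|[|[|[|[|[|i]]]]]] // ?] /=; rewrite ?scale1r.
  - by apply: sigma_fix; rewrite !inE eqxx.
  - by apply: sigma_transp; rewrite -val_eqE !val_pt.
  - by apply: sigma_transp; rewrite -val_eqE !val_pt.
  - by apply: sigma_transp; rewrite -val_eqE !val_pt.
  - by apply: sigma_fix; rewrite !inE eqxx orbT.
  - by apply: sigma_fix; rewrite !inE eqxx !orbT.
have encE C a c : is_encoder (code_rows a c) C -> C = row_code a c by case.
split; [|split].
- move=> C; split=> [[minC Cg2]|[a [c [/admissible_coprime ac /encE ->]]]].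
    have [a [c [ac ->]]] := minimal_code_row_code sigma_b minC Cg2.
    by exists a, c; split; [left|exact: (row_code_encoder sigma ac)].
  exact: row_code_minimal.
- move=> a c /admissible_coprime ac; exists (row_code a c).
  exact: (row_code_encoder sigma ac).
move=> a c C /admissible_coprime ac encC; split; first by exists (code_rows a c).
split; first by exists 2%N, (code_rows a c).
move=> k G encG; have k2 := encoder_rank_unique encC encG; subst k.
by rewrite (max_minor_deg_unique encC encG) code_rows_max_minor.
Qed.
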